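(* Let $(\Omega^\delta;a^\delta,b^\delta)$ be a simply connected spin-domain on a $\delta$-isoradial graph and let $F^\delta:\Omega^\delta_\diamondsuit\to\mathbb C$ be the holomorphic fermion of the critical spin-Ising model. For each pair of neighbors $z_0,z_1\in\Omega^\delta_\diamondsuit$ separated by an edge $(w_1u)$ of $\Lambda$ ($u\in\Gamma$, $w_1\in\Gamma^*$) we have $$\mathrm{Proj}\big[F^\delta(z_0);[i(w_1-u)]^{-\frac12}\big]=\mathrm{Proj}\big[F^\delta(z_1);[i(w_1-u)]^{-\frac12}\big].$$
   Context: **Lattice.** Let $\delta>0$. A planar graph $\Gamma$ embedded in $\mathbb C$ is $\delta$-isoradial if each face is inscribed in a circle of radius $\delta$; the circle centers are assumed to lie inside the faces and are the vertices of the dual graph $\Gamma^*$. Vertices of $\Gamma$ are ''black'', vertices of $\Gamma^*$ ''white''. $\Lambda=\Gamma\cup\Gamma^*$, with edges $[uw]$ joining $u\in\Gamma$ to the center $w\in\Gamma^*$ of an incident face; the faces of $\Lambda$ are rhombi $u_1w_1u_2w_2$ with side $\delta$. All rhombi angles lie in $[\eta,\pi-\eta]$ for some fixed $\eta>0$. $\theta(z)$ is the half-angle of the rhombus centered at $z$ at its black vertices ($\tan\theta(z)=|w_2-w_1|/|u_2-u_1|$); $e_z=[u_1u_2]$ is the edge of $\Gamma$ through $z$. **Notation.** $X\parallel Y$ means that $X$ is a real multiple of $Y$; $\mathrm{Proj}[X;u]=\frac X2+\frac{\overline Xu^2}{2|u|^2}$ is the orthogonal projection on $u\mathbb R$. **Spin-domain.**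 $\Omega^\delta$ is a simply connected polygonal domain composed of inner rhombi (centers $\mathrm{Int}\,\Omega^\delta_\diamondsuit$) and boundary half-rhombi, whose boundary is a closed path of $\Gamma^*$: each boundary half-rhombus is a triangle $u_{\mathrm{int}}w_1w_2$ with $[w_1w_2]\subset\partial\Omega^\delta$ and center $\zeta=\frac12(w_1+w_2)\in\partial\Omega^\delta_\diamondsuit$; $u_{\mathrm{out}}$ is the fourth vertex of the full rhombus; $\tau(\zeta)=w_2-w_1$ is oriented counterclockwise. No edge of $\Gamma^*$ breaks $\Omega^\delta$ into two non-connected pieces. $\Omega^\delta_\diamondsuit=\mathrm{Int}\,\Omega^\delta_\diamondsuit\cup\partial\Omega^\delta_\diamondsuit$; $z_0,z_1$ are neighbors if the (half-)rhombi share an edge of $\Lambda$; $a^\delta\ne b^\delta$ are marked points of $\partial\Omega^\delta_\diamondsuit$. **Spin-Ising fermion.** For $z\in\Omega^\delta_\diamondsuit$, $z\neq a^\delta$, an interface picture from $a^\delta$ to $z$ is a set consisting of $e_{a^\delta}$ (traversed from $u_{\mathrm{out}}(a^\delta)$ into the domain), of some edges $e_{z'}$ with $z'\in\mathrm{Int}\,\Omega^\delta_\diamondsuit\setminus\{z\}$, and of exactly one half of $e_z$ (a segment from $z$ to an endpoint of $e_z$; for $z\in\partial\Omega^\delta_\diamondsuit$ the half $[u_{\mathrm{int}}(z),z]$), such that every vertex of $\Gamma$ inside $\Omega^\delta$ is incident to an even number of these edges and half-edges. Its weight is $\tan\frac12\theta(a^\delta)\cdot[\cos\frac12\theta(z)]^{-1}\cdot\prod\tan\frac12\theta(z')$,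 the product being over the edges $e_{z'}$ in the picture. For $z=a^\delta$ the interface is the half-edge $[u_{\mathrm{out}}(a^\delta),a^\delta]$ with weight $[\cos\frac12\theta(a^\delta)]^{-1}$, together with a set of edges $e_{z'}$, $z'\in\mathrm{Int}\,\Omega^\delta_\diamondsuit$, having even degree at every vertex. $\widetilde Z_{(\Omega^\delta;a^\delta\rightsquigarrow z)}$ is the total weight of all pictures and $\mathbb E_{(\Omega^\delta;a^\delta\rightsquigarrow z)}$ the expectation for the corresponding probability measure. Each picture splits into loops and an interface $\gamma^\delta$ running from $a^\delta$ to $z$, drawn so that it takes the left-most possible route whenever there is a choice; $\mathrm{wind}(\gamma^\delta;a^\delta\rightsquigarrow z)$ is its total signed turn in radians (for $z=b^\delta$ it does not depend on the picture and is denoted $\mathrm{wind}(a^\delta\rightsquigarrow b^\delta)$). (For $z=b^\delta$ the pictures are the domain walls of spin configurations on $\Gamma^*$ with Dobrushin boundary conditions: $-$ on the arc $(a^\delta b^\delta)$, $+$ on $(b^\delta a^\delta)$.) The fermion is $$F^\delta(z)=\mathcal F^\delta(b^\delta)\cdot\frac{\widetilde Z_{(\Omega^\delta;a^\delta\rightsquigarrow z)}\cdot\mathbb E_{(\Omega^\delta;a^\delta\rightsquigarrow z)}e^{-\frac i2\mathrm{wind}(\gamma^\delta;a^\delta\rightsquigarrow z)}}{\widetilde Z_{(\Omega^\delta;a^\delta\rightsquigarrow b^\delta)}\cdot e^{-\frac i2\mathrm{wind}(a^\delta\rightsquigarrow b^\delta)}},$$ where $\mathcal F^\delta(b^\delta)\parallel(\tau(b^\delta))^{-1/2}$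 is a nonzero normalizing factor depending only on the lattice near $b^\delta$. *)

(* Defs.v *)
From HB Require Import structures.
From mathcomp Require Import all_boot all_order all_algebra.
From mathcomp Require Import all_classical all_reals all_analysis.
From mathcomp Require Import complex.

Set Implicit Arguments.
Unset Strict Implicit.
Unset Printing Implicit Defensive.

Import Order.TTheory GRing.Theory Num.Theory numFieldNormedType.Exports.
Local Open Scope classical_set_scope.
Local Open Scope complex_scope.
Local Open Scope ring_scope.

Section Plane.
Variable R : realType.
Implicit Types (p q r x y : R[i]) (t : R).

(* The signed area spanned by x and y: positive iff y is to the left of x. *)
Definition cross x y : R := complex.Im (x^*%C * y).

(* The argument in ]-pi, pi] of a nonzero complex number. *)
Definition carg x : R :=
  let t := acos (complex.Re x / Normc.normc x) in if 0 <= complex.Im x then t else - t.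

Definition cexpi t : R[i] := cos t +i* sin t.

Definition parallel x y : Prop := exists t, x = t%:C * y.

Definition Proj x y : R[i] := x / 2 + x^*%C * y ^+ 2 / (2 * `|y| ^+ 2).

(* The total signed turn (counterclockwise positive) of the polygonal line
   p, q, s_0, s_1, ... *)
Fixpoint wind_from p q (s : seq R[i]) : R :=
  if s is r :: s' then carg ((r - q) / (q - p)) + wind_from q r s' else 0.

Definition wind (s : seq R[i]) : R :=
  if s is p :: q :: s' then wind_from p q s' else 0.

Definition segment p q : set R[i] :=
  [set x | exists2 t, 0 <= t <= 1 & x = p + t%:C * (q - p)].

Definition triangle p q r : set R[i] :=
  [set x | exists a b c : R, [/\ 0 <= a, 0 <= b, 0 <= c, a + b + c = 1 &
     x = a%:C * p + b%:C * q + c%:C * r]].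

(* R[i]^o is R[i] with the topology given by the modulus. *)
Definition cinterior (A : set R[i]) : set R[i] := (A : set R[i]^o)°.
Definition cclosure (A : set R[i]) : set R[i] := closure (A : set R[i]^o).
Definition cconnected (A : set R[i]) : Prop := connected (A : set R[i]^o).

Definition loop_in (A : set R[i]) (g : R -> R[i]^o) : Prop :=
  [/\ {within `[0, 1], continuous g}, g 0 = g 1 &
      forall t, 0 <= t <= 1 -> A (g t)].

Definition null_homotopic (A : set R[i]) (g : R -> R[i]^o) : Prop :=
  exists H : R * R -> R[i]^o,
  [/\ {within `[0, 1] `*` `[0, 1], continuous H},
      forall t, 0 <= t <= 1 -> H (0, t) = g t /\ H (1, t) = H (1, 0),
      forall s, 0 <= s <= 1 -> H (s, 0) = H (s, 1) &
      forall s t, 0 <= s <= 1 -> 0 <= t <= 1 -> A (H (s, t))].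

(* This is used for open sets only, for which connectedness and
   path-connectedness coincide. *)
Definition simply_connected (A : set R[i]) : Prop :=
  cconnected A /\ forall g, loop_in A g -> null_homotopic A g.

(* The rhombus black1 white1 black2 white2, listed counterclockwise. *)
Record rhombus := Rhombus {
  black1 : R[i]; white1 : R[i]; black2 : R[i]; white2 : R[i] }.

Definition black_end (k : rhombus) (b : bool) : R[i] :=
  if b then black1 k else black2 k.

Definition center (k : rhombus) : R[i] := (black1 k + black2 k) / 2.

Definition theta (k : rhombus) : R :=
  atan (Normc.normc (white2 k - white1 k) / Normc.normc (black2 k - black1 k)).

(* [s] lists the vertices of a polygon counterclockwise. *)
Definition side (s : seq R[i]) p q : Prop := p \in s /\ q = next s p.

Definition closed_polygon (s : seq R[i]) : set R[i] :=
  [set x | forall p, p \in s -> 0 <= cross (next s p - p) (x - p)].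

Definition open_polygon (s : seq R[i]) : set R[i] :=
  [set x | forall p, p \in s -> 0 < cross (next s p - p) (x - p)].

(* The edge [black1 black2] has the face of white1 on one side and the face
   of white2 on the other side. *)
Definition dual_edge (W : set R[i]) (f : R[i] -> seq R[i]) (k : rhombus) :
    Prop :=
  [/\ W (white1 k), W (white2 k), side (f (white1 k)) (black2 k) (black1 k) &
      side (f (white2 k)) (black1 k) (black2 k)].

End Plane.

(* A planar graph Gamma is given by its faces, which are convex polygons as
   they are inscribed in circles.  [white] is the set of the circle centers,
   [face w] the polygon with center w; the vertices and the edges of Gamma are
   the vertices and the sides of these polygons, which tile the plane edge to
   edge. *)
Record isoradial (R : realType) (delta eta : R) := Isoradial {
  white : set R[i];
  face : R[i] -> seq R[i];
  delta_gt0 : 0 < delta;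
  eta_gt0 : 0 < eta;
  face_uniq : forall w, white w -> uniq (face w) /\ (2 < size (face w))%N;
  face_convex : forall w u, white w -> u \in face w -> closed_polygon (face w) u;
  face_circle : forall w u, white w -> u \in face w -> Normc.normc (u - w) = delta;
  face_center : forall w, white w -> open_polygon (face w) w;
  face_cover : forall x, exists2 w, white w & closed_polygon (face w) x;
  face_disjoint : forall w w', white w -> white w' -> w != w' ->
    open_polygon (face w) `&` open_polygon (face w') = set0;
  face_edge : forall w u u', white w -> side (face w) u u' ->
    exists2 w', white w' & side (face w') u' u;
  (* the angles of the rhombus k are 2 * theta k and pi - 2 * theta k *)
  angle_bound : forall k, dual_edge white face k ->
    eta <= 2 * theta k <= pi - eta }.

Definition diamond (R : realType) (delta eta : R) (L : isoradial delta eta)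
  (k : rhombus R) : Prop := dual_edge (white L) (face L) k.

Section Region.
Variables (R : realType) (T : finType) (shape : T -> rhombus R) (bd : {set T}).

(* For a boundary half-rhombus z, black1 is u_int and black2 is u_out. *)
Definition inside_half (h : T * bool) : bool := (h.1 \notin bd) || h.2.

Definition region : set R[i] :=
  cinterior [set x | exists2 h : T * bool, inside_half h &
    triangle (black_end (shape h.1) h.2)
             (white1 (shape h.1)) (white2 (shape h.1)) x].

Definition white_boundary : set R[i] :=
  [set x | exists2 z, z \in bd & segment (white1 (shape z)) (white2 (shape z)) x].

End Region.

(* [tile] is the set Omega_diamond of all the (half-)rhombi, and [bdry] is the
   set of boundary half-rhombi. *)
Record spin_domain (R : realType) (delta eta : R) (L : isoradial delta eta) :=
  SpinDomain {
  tile :> finType;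
  shape : tile -> rhombus R;
  bdry : {set tile};
  tile_diamond : forall z, diamond L (shape z);
  center_inj : injective (fun z => center (shape z));
  region_simply_connected : simply_connected (region shape bdry);
  region_frontier : cclosure (region shape bdry) `\` region shape bdry =
                    white_boundary shape bdry;
  boundary_path : exists s : seq tile, [/\ uniq s, s =i bdry &
    cycle [rel y z | white2 (shape y) == white1 (shape z)] s];
  no_breaking_edge : forall k, diamond L k ->
    cconnected (region shape bdry `\` segment (white1 k) (white2 k)) }.

Section Fermion.
Variables (R : realType) (delta eta : R) (L : isoradial delta eta).
Variable Om : spin_domain L.
Implicit Types (z : Om) (S : {set Om}).

(* The half-edge h = (z, b) is the segment [ctr z, tip h]. *)
Local Notation halfedge := (Om * bool)%type.
Implicit Types (h g : halfedge) (P : {set halfedge}).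

Definition ctr z : R[i] := center (shape z).
Definition tip h : R[i] := black_end (shape h.1) h.2.
Definition inside h : bool := inside_half (bdry Om) h.
Definition half_angle z : R := theta (shape z).
Definition tau z : R[i] := white2 (shape z) - white1 (shape z).

Definition lambda_edge z (u w : R[i]) : Prop :=
  (exists2 b, inside (z, b) & u = tip (z, b)) /\
  (w = white1 (shape z) \/ w = white2 (shape z)).

(* The turn from h, traversed towards its tip, to g, traversed from its tip. *)
Definition turn h g : R := carg ((ctr g.1 - tip h) / (tip h - ctr h.1)).

Definition leftmost P h g : bool :=
  [&& g \in P, tip g == tip h &
      [forall (g' | (g' \in P) && (tip g' == tip h)), turn h g' <= turn h g]].

(* The route from the tip of h (after h) along the half-edges of P, each used
   at most once; it stops at the end of an edge with only one half in P. *)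
Fixpoint route (n : nat) P h : seq R[i] :=
  if n is n'.+1 then
    if [pick g | leftmost P h g] is Some g then
      let g' := (g.1, ~~ g.2) in
      if g' \in P then tip g' :: route n' (P :\ g :\ g') g' else [:: ctr g.1]
    else [::]
  else [::].

Variables a b : Om.

(* A picture from a to z is coded by (S, c), where S is the set of the edges
   e_z' other than e_a and (z, c) is the half of e_z; for z = a this is the
   outer half. *)
Definition picture_code := ({set Om} * bool)%type.

(* The half-edges of a picture that lie inside the domain. *)
Definition halves z (p : picture_code) : {set halfedge} :=
  [set h : halfedge | h.1 \in p.1]
  :|: (if z == a then finset.set0 else [set (a, true); (z, p.2)])%SET.

Definition degree P (u : R[i]) : nat := #|[set h in P | tip h == u]%SET|.

(* The boundary contains no black vertex, hence the vertices of Gamma inside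
   the domain are those of its (half-)rhombi. *)
Definition is_picture z (p : picture_code) : bool :=
  [&& p.1 \subset (~: bdry Om :\ z)%SET,
      if z == a then ~~ p.2 else inside (z, p.2) &
      [forall (h | inside h), ~~ odd (degree (halves z p) (tip h))]].

Definition weight z (p : picture_code) : R :=
  (if z == a then 1 else tan (half_angle a / 2)) * (cos (half_angle z / 2))^-1
  * \prod_(z' in p.1) tan (half_angle z' / 2).

Definition interface z (p : picture_code) : seq R[i] :=
  tip (a, false) ::
  if z == a then [:: ctr a]
  else tip (a, true) ::
    route #|halves z p| (halves z p :\ (a, true))%SET (a, true).

Definition partition_function z : R := \sum_(p | is_picture z p) weight z p.

Definition expectation z (X : picture_code -> R[i]) : R[i] :=
  \sum_(p | is_picture z p) (weight z p / partition_function z)%:C * X p.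

(* The winding of all the pictures from a to b is the same: take any one. *)
Definition wind_ab : R :=
  if [pick p | is_picture b p] is Some p then wind (interface b p) else 0.

Definition fermion (Fb : R[i]) z : R[i] :=
  Fb * ((partition_function z)%:C
        * expectation z (fun p => cexpi (- (wind (interface z p) / 2))))
     / ((partition_function b)%:C * cexpi (- (wind_ab / 2))).

End Fermion.

(* Main.v *)
(* Fix a direction in which distinct vertices have distinct heights, and order
   the half-edges by the height of their vertex, then by their angle.  Drawing
   each edge as a chord between its two half-edges on the ordered line, the key
   planar fact is that in an even set of edges the number of pairs of linked
   chords has the parity of the number of edges: a pair of edges without common
   vertex is linked iff exactly one of the vertices seen inside the height range
   of the other edge lies to its right, because the edges do not cross, and
   summing over all pairs, even degrees make these contributions cancel.

   Writing e^(-i wind / 2) as a product over the turns of the interface, where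
   each turn and each edge contributes a sign given by the order, the planar fact
   turns it into e^(-i (difference of the end directions) / 2) times a sign that
   depends only on the set of edges and on the two ends, not on the way in which
   the picture is split into an interface and loops: choosing the left-most
   half-edge at a vertex makes it adjacent in the order, so that the loops left
   over do not change the parity.

   The projection of F(z) is then computed for one z at a time.  Moving the end
   of a picture from z to the corner between [u z] and [u w1], by removing the
   half of e_z at u if it is the last one and by completing e_z otherwise,
   multiplies the phase by a number of real part cos(theta / 2), resp.
   sin(theta / 2), which compensates the weight.  The result is a sum over
   pictures ending at the corner, where z does not appear. *)
Require Import Defs.
From HB Require Import structures.
From mathcomp Require Import all_boot all_order all_algebra.
From mathcomp Require Import all_classical all_reals all_analysis.
From mathcomp Require Import complex ring lra.
Set Implicit Arguments.
Unset Strict Implicit.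
Unset Printing Implicit Defensive.
Import Order.TTheory GRing.Theory Num.Theory numFieldNormedType.Exports.

Notation "\xor_ ( i 'in' A ) F" := (\big[addb/false]_(i in A) F)
  (at level 41, i, A at level 50, F at level 41).

(** * Linked chords *)

Section Parity.
Variable A : finType.
Implicit Types (P : {set A}) (b : pred A).

Lemma xor_card P b : \xor_(y in P) b y = odd #|[set y in P | b y]|.
Proof.
rewrite -sum1_card (big_morph odd oddD (erefl _)) [RHS]big_mkcond [LHS]big_mkcond /=.
by apply: eq_bigr => y _; rewrite inE; case: (y \in P); case: (b y).
Qed.

Lemma xor_const P : \xor_(y in P) true = odd #|P|.
Proof. by rewrite xor_card; congr (odd #|pred_of_set _|); apply/setP=> y;
  rewrite inE andbT. Qed.

(** Group [P] by the value of [t]: [phi] is constant on each fibre, and every fibre has even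
    size. *)
Lemma xor_even (V : eqType) (t : A -> V) P (phi : V -> bool) :
  (forall y, y \in P -> ~~ odd #|[set x in P | t x == t y]|) ->
  \xor_(y in P) phi (t y) = false.
Proof.
move=> evenP; rewrite xor_card; set Q := [set y in P | _].
rewrite (card_partition (preim_partitionP t Q)) (big_morph odd oddD (erefl _)) big1 //
  => B /imsetP[y yQ ->].
apply/negbTE; move: yQ; rewrite inE => /andP[yP phiy].
suff -> : [set x in Q | t y == t x] = [set x in P | t x == t y] by apply: evenP.
apply/setP=> x; rewrite !inE eq_sym; case: eqP => [->|]; last by rewrite !andbF.
by rewrite phiy !andbT.
Qed.

Lemma xor_local (V : eqType) (t : A -> V) (v : V) P b (c : bool) :
  (forall y, y \in P -> b y = (t y == v) && c) ->
  \xor_(y in P) b y = c && odd #|[set y in P | t y == v]|.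
Proof.
move=> bP; rewrite (eq_bigr (fun y => (t y == v) && c)) //.
case: c {bP} => /=; first by rewrite -xor_card; apply: eq_bigr => y _; rewrite andbT.
by rewrite big1 // => y _; rewrite andbF.
Qed.

End Parity.

Section Pairs.
Variable T : finType.
Implicit Types (F : {set T}) (c : T -> T -> bool) (e f : T).

(** Each unordered pair contributes once; [enum_rank] chooses its representative. *)
Definition xor_pairs F c :=
  \xor_(e in F) \xor_(f in F) ((enum_rank e < enum_rank f)%N && c e f).

Lemma xor_pairsU1 F c x : x \notin F ->
    (forall e, e \in F -> c e x = c x e) ->
  xor_pairs (x |: F) c = (\xor_(e in F) c e x) (+) xor_pairs F c.
Proof.
move=> xF csym; rewrite /xor_pairs big_setU1 //= big_setU1 //= ltnn /=.
rewrite [X in _ (+) X = _](eq_bigr (fun e =>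
  ((enum_rank e < enum_rank x)%N && c e x) (+)
   \xor_(f in F) ((enum_rank e < enum_rank f)%N && c e f))); last first.
  by move=> e _; rewrite big_setU1.
rewrite big_split /= addbA -big_split /=; congr (_ (+) _).
apply: eq_bigr => e eF; rewrite csym //.
have : enum_rank e != enum_rank x by apply: contraNneq xF => /enum_rank_inj <-.
by rewrite neq_ltn; case: ltngtP => //= _ _; rewrite ?addbF.
Qed.

(** The ordered pairs split into those increasing for [enum_rank], those decreasing, and the
    diagonal. *)
Lemma xor_double F c :
  \xor_(e in F) \xor_(f in F) c e f =
  xor_pairs F (fun e f => c e f (+) c f e) (+) \xor_(e in F) c e e.
Proof.
have -> : xor_pairs F (fun e f => c e f (+) c f e) =
   xor_pairs F c (+) \xor_(e in F) \xor_(f in F) ((enum_rank f < enum_rank e)%N && c e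
     f).
  rewrite /xor_pairs [X in _ (+) X]exchange_big /= -big_split /=.
  apply: eq_bigr => e _; rewrite -big_split /=; apply: eq_bigr => f _.
  by rewrite andb_addr.
rewrite /xor_pairs -!big_split /=; apply: eq_bigr => e eF.
have -> : c e e = \xor_(f in F) ((enum_rank e == enum_rank f) && c e f).
  rewrite (bigD1 e) //= eqxx big1 ?addbF // => f /andP[_ fe].
  by rewrite (inj_eq enum_rank_inj) eq_sym (negbTE fe).
rewrite -!big_split /=; apply: eq_bigr => f _.
by rewrite -val_eqE /=; case: ltngtP; rewrite ?addbF ?addFb.
Qed.

Lemma xor_pairs_split F c1 c2 :
  xor_pairs F (fun e f => c1 e f (+) c2 e f) = xor_pairs F c1 (+) xor_pairs F c2.
Proof.
rewrite /xor_pairs -big_split; apply: eq_bigr => e _ /=; rewrite -big_split /=.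
by apply: eq_bigr => f _; rewrite andb_addr.
Qed.

Lemma eq_xor_pairs F c1 c2 : (forall e f, e \in F -> f \in F -> e != f -> c1 e f =
  c2 e f) ->
  xor_pairs F c1 = xor_pairs F c2.
Proof.
move=> c12; apply: eq_bigr => e eF; apply: eq_bigr => f fF.
case: (eqVneq e f) => [->|ef]; first by rewrite ltnn.
by rewrite c12.
Qed.

Definition halves_of F : {set T * bool} := [set y | y.1 \in F].

Lemma xor_halves F (b : pred (T * bool)) :
  \xor_(y in halves_of F) b y = \xor_(e in F) (b (e, true) (+) b (e, false)).
Proof.
rewrite (eq_bigl (fun y : T * bool => (y.1 \in F) && true)); last by move=> y;
  rewrite !inE andbT.
rewrite (eq_bigr (fun y => b (y.1, y.2))); last by case.
rewrite -(pair_big (fun e => e \in F) (fun _ => true) (fun e a => b (e, a))) /=.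
by apply: eq_bigr => e _; rewrite big_bool.
Qed.

End Pairs.

Section Chords.
Variables (T : finType) (V : eqType) (t : T * bool -> V) (lt : rel (T * bool)).
Hypothesis lt_total : forall y x, y != x -> lt y x = ~~ lt x y.
Implicit Types (F : {set T}) (e f : T).

Definition even_at F := forall v, ~~ odd #|[set y in halves_of F | t y == v]|.

(* If lt is total and e <> f: whether exactly one end of f lies between the two
   ends of e. *)
Definition link e f :=
  (lt (e, true) (f, true) (+) lt (e, false) (f, true)) (+)
  (lt (e, true) (f, false) (+) lt (e, false) (f, false)).

(** Totality negates each of the four comparisons, and four negations cancel. *)
Lemma link_sym e f : e != f -> link e f = link f e.
Proof.
move=> ef; have tot b c : lt (f, b) (e, c) = ~~ lt (e, c) (f, b).
  by apply: lt_total; apply: contra_neq ef => -[].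
rewrite /link !tot; move: (lt _ _) (lt _ _) (lt _ _) (lt _ _).
by do 4!case.
Qed.

Definition linking F := xor_pairs F link.

Variables (L : T -> V -> bool) (top : T -> bool).
Hypothesis top_neq : forall e, t (e, top e) != t (e, ~~ top e).
Hypothesis L_irr : forall e b, L e (t (e, b)) = false.
Hypothesis linkE : forall e f, e != f -> link e f =
  ((L e (t (f, true)) (+) L e (t (f, false))) (+)
   (L f (t (e, true)) (+) L f (t (e, false)))) (+)
  ((t (e, top e) == t (f, ~~ top f)) (+) (t (f, top f) == t (e, ~~ top e))).

(* L e x stands for: x lies strictly between the heights of the ends of e, to
   the right of e.  Summed over the pairs of edges, the two middle groups of
   linkE count each (edge, vertex) pair with the degree of the vertex, which is
   even; in the last group, at each vertex, the number of pairs (edge from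
   below, edge from above) has the parity of the number of edges from below. *)
Lemma linking_even F : even_at F -> linking F = odd #|F|.
Proof.
move=> evF.
pose c1 e f := L e (t (f, true)) (+) L e (t (f, false)).
pose c2 e f := t (e, top e) == t (f, ~~ top f).
pose c3 e f := t (e, top e) == t (f, top f).
have xh e (phi : V -> bool) : \xor_(f in F) (phi (t (f, true)) (+) phi (t (f,
  false))) = false.
  rewrite -(xor_halves F (fun y => phi (t y))).
  by apply: xor_even => y yF; have := evF (t y); rewrite /halves_of.
rewrite /linking (@eq_xor_pairs _ F _ (fun e f =>
  (c1 e f (+) c1 f e) (+) (c2 e f (+) c2 f e))); last first.
  by move=> e f _ _ ef; rewrite linkE.
rewrite xor_pairs_split.
have := xor_double F c1; rewrite big1; last by move=> e _; apply: xh.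
rewrite big1; last by move=> e _; rewrite /c1 !L_irr.
rewrite addbF => <-; rewrite addFb.
have := xor_double F c2; rewrite [X in _ (+) X]big1; last first.
  by move=> e _; apply/negbTE; exact: top_neq.
rewrite addbF => <-.
(* The degree at the upper end of [e] is even, so the edges starting upwards there and those
   arriving from below have the same parity. As [c3] is symmetric, only its diagonal will survive:
   one unit per edge. *)
have -> : \xor_(e in F) \xor_(f in F) c2 e f = \xor_(e in F) \xor_(f in F) c3 e f.
  apply: eq_bigr => e _; apply: (@addIb (\xor_(f in F) c3 e f)).
  rewrite addbb -big_split /=.
  rewrite -[RHS](xh e (fun v => v == t (e, top e))); apply: eq_bigr => f _.
  rewrite /c2 /c3 ![t (e, _) == _]eq_sym; by case: (top f); rewrite //= addbC.
rewrite xor_double (@eq_xor_pairs _ F _ (fun _ _ => false)); last first.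
  by move=> e f _ _ _; rewrite /c3 eq_sym addbb.
rewrite {1}/xor_pairs big1 => [|e _]; last by rewrite big1 // => f _; rewrite andbF.
by rewrite addFb -xor_const; apply: eq_bigr => e _; rewrite /c3 eqxx.
Qed.

End Chords.

Local Open Scope classical_set_scope.
Local Open Scope complex_scope.
Local Open Scope ring_scope.

(** * Half-angles *)

Section Conjugation.
Variable R : realType.
Implicit Types x y : R[i].

Lemma conjM x y : (x * y)^*%C = x^*%C * y^*%C.
Proof. exact: rmorphM. Qed.

Lemma conjR (r : R) : (r%:C)^*%C = r%:C.
Proof. by rewrite /= oppr0. Qed.

Lemma conj_sign (b : bool) : ((-1) ^+ b)^*%C = (-1) ^+ b :> R[i].
Proof. by case: b; rewrite ?expr0 ?expr1 ?rmorphN rmorph1. Qed.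

Lemma conj_i : ('i%C)^*%C = - 'i%C :> R[i].
Proof. by apply/eqP; rewrite eq_complex /= oppr0 !eqxx. Qed.

Lemma conjK x : (x^*%C)^*%C = x.
Proof. by case: x => a b /=; rewrite opprK. Qed.

End Conjugation.

Section HalfAngle.
Variable R : realType.
Implicit Types (v w x y : R[i]).

(* With the argument t of v taken in ]0, 2 pi[: kap v = - cot (t / 2), which
   increases with t, and hroot v = e^(i t / 2). *)
Definition kap v : R := - ((Normc.normc v + complex.Re v) / complex.Im v).

Definition hroot v : R[i] :=
  let r := (Num.sqrt (1 + kap v ^+ 2))^-1 in (- kap v * r) +i* r.

Definition unimod x := complex.Re x ^+ 2 + complex.Im x ^+ 2 = 1.

Lemma normc_sqr x : Normc.normc x ^+ 2 = complex.Re x ^+ 2 + complex.Im x ^+ 2.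
Proof. by case: x => a b /=; rewrite sqr_sqrtr // addr_ge0 ?sqr_ge0. Qed.

Lemma normc_ge0 x : 0 <= Normc.normc x.
Proof. by case: x => a b /=; rewrite sqrtr_ge0. Qed.

Lemma normc_gt_Re v : complex.Im v != 0 -> `|complex.Re v| < Normc.normc v.
Proof.
move=> v0; rewrite -(ltr_pXn2r (n := 2)) ?nnegrE ?normc_ge0 // normc_sqr.
by rewrite real_normK ?num_real // ltrDl exprn_even_gt0.
Qed.

Let rt_pos v : 0 < (Num.sqrt (1 + kap v ^+ 2))^-1.
Proof. by rewrite invr_gt0 sqrtr_gt0 ltr_pwDl // sqr_ge0. Qed.

Let rt_sqr v : (Num.sqrt (1 + kap v ^+ 2))^-1 ^+ 2 = (1 + kap v ^+ 2)^-1.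
Proof. by rewrite exprVn sqr_sqrtr // addr_ge0 // sqr_ge0. Qed.

Lemma hroot_Im_gt0 v : 0 < complex.Im (hroot v).
Proof. exact: rt_pos. Qed.

Lemma hroot_Re v : complex.Re (hroot v) = - kap v * complex.Im (hroot v).
Proof. by []. Qed.

Lemma hroot_unimod v : unimod (hroot v).
Proof.
have k0 : 1 + kap v ^+ 2 != 0 by rewrite gt_eqF // ltr_pwDl // sqr_ge0.
rewrite /unimod hroot_Re exprMn sqrrN /= rt_sqr -{2}[_^-1]mul1r -mulrDl addrC.
by rewrite mulfV.
Qed.

Let kapE v : complex.Im v != 0 ->
  kap v * complex.Im v = - (Normc.normc v + complex.Re v).
Proof. by move=> v0; rewrite /kap mulNr divfK. Qed.

(** With [n] the modulus and [a] the real part of [v], the half-angle formula says that the square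
    of [kap v] is (n + a) / (n - a). This is [k2] below, and both coordinates follow from it. *)
Lemma hrootE v : complex.Im v != 0 -> v = (Normc.normc v)%:C * hroot v ^+ 2.
Proof.
move=> v0; have kE := kapE v0; have ns := normc_sqr v.
have := hroot_unimod v; rewrite /unimod hroot_Re.
have := hroot_Re v; move: kE ns v0; move: (kap v) (hroot v) (Normc.normc v).
case: v => a b k [p q] n /= kE ns b0 -> u1; simpc.
have k2 : (n - a) * k ^+ 2 = n + a.
  apply: (@mulIf _ (b ^+ 2)); first by rewrite sqrf_eq0.
  have -> : (n - a) * k ^+ 2 * b ^+ 2 = (n - a) * (k * b) ^+ 2 by ring.
  rewrite kE; have -> : b ^+ 2 = n ^+ 2 - a ^+ 2 by lra.
  by ring.
apply/eqP; rewrite eq_complex /=; apply/andP; split; apply/eqP.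
  have -> : n * (k * q * (k * q) - q * q) = n * (k ^+2 - 1) * q ^+ 2 by ring.
  have -> : n * (k ^+ 2 - 1) = a * (1 + k ^+ 2) by lra.
  by transitivity (a * ((- k * q) ^+ 2 + q ^+ 2)); [rewrite u1 mulr1 | ring].
apply: (@mulIf _ b) => //.
have -> : n * (- (k * q * q) - q * (k * q)) * b = - (k * b) * 2 * n * q ^+ 2 by ring.
rewrite kE; transitivity (b * b * ((- k * q) ^+ 2 + q ^+ 2)); first by rewrite u1 mulr1.
have -> : b * b = n ^+ 2 - a ^+ 2 by rewrite -expr2; lra.
have -> : (- k * q) ^+ 2 = k ^+ 2 * q ^+ 2 by ring.
have -> : (n ^+ 2 - a ^+ 2) * (k ^+ 2 * q ^+ 2 + q ^+ 2) =
  (n + a) * (((n - a) * k ^+ 2) + (n - a)) * q ^+2 by ring.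
rewrite k2; ring.
Qed.

(** The half-arguments of [v] and [- v] differ by a right angle, so their cotangents are negative
    inverses. *)
Lemma kapN v : complex.Im v != 0 -> kap v * kap (- v) = -1.
Proof.
move=> v0; have ns := normc_sqr v.
rewrite /kap; case: v v0 ns => a b /= b0; rewrite !sqrrN; set n : R := Num.sqrt _ => ns.
rewrite ?invrN ?mulrN ?opprK; apply: (@mulIf _ (b ^+ 2)); first by rewrite sqrf_eq0.
transitivity (- ((n + a) * (n - a))); first by field.
have -> : b ^+ 2 = n ^+ 2 - a ^+ 2 by lra.
by ring.
Qed.

Lemma kap_gt0 v : complex.Im v != 0 -> (0 < kap v) = (complex.Im v < 0).
Proof.
move=> v0; have := normc_gt_Re v0; rewrite ltr_norml => /andP[n1 n2].
rewrite /kap oppr_gt0 pmulr_rlt0 ?invr_lt0 //; lra.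
Qed.

Lemma kap_lt0 v : complex.Im v != 0 -> (kap v < 0) = (0 < complex.Im v).
Proof.
move=> v0; have := normc_gt_Re v0; rewrite ltr_norml => /andP[n1 n2].
rewrite /kap oppr_lt0 pmulr_rgt0 ?invr_gt0 //; lra.
Qed.

Lemma kapZ (t : R) v : 0 < t -> kap (t%:C * v) = kap v.
Proof.
move=> t0; case: v => a b;
  rewrite /kap Normc.normcM /= mul0r !mul0r subr0 addr0 expr0n addr0 sqrtr_sqr
    gtr0_norm //.
by rewrite -mulrDr -mulf_div divff ?mul1r // gt_eqF.
Qed.

(** The half-arguments differ by a right angle; its sign depends on the half-plane of [v] because
    the argument is cut along the positive real axis. *)
Lemma hrootN v : complex.Im v != 0 ->
  (hroot v)^*%C = (-1) ^+ (complex.Im v < 0)%R * 'i%C * (hroot (- v))^*%C.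
Proof.
move=> v0; have v0' : complex.Im (- v) != 0 by case: v v0 => a b /=; rewrite oppr_eq0.
have := kapN v0; rewrite -(kap_gt0 v0).
have := hroot_unimod v; have := hroot_unimod (- v); rewrite /unimod !hroot_Re.
have := hroot_Re v; have := hroot_Re (- v).
have := hroot_Im_gt0 v; have := hroot_Im_gt0 (- v).
move: (kap v) (hroot v) (kap (- v)) (hroot (- v)) => k [p q] k' [p' q'] /= q'0 q0 ->
  -> u' u kk.
clear v v0 v0'.
have q'E : q' ^+ 2 = (k * q) ^+ 2.
  have k0 : k != 0 by apply/eqP => k0; move: kk; rewrite k0 mul0r => /eqP;
    rewrite eq_sym oppr_eq0 oner_eq0.
  apply: (@mulfI _ (1 + k ^+ 2)); first by rewrite gt_eqF // ltr_pwDl // sqr_ge0.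
  transitivity (k ^+ 2).
    transitivity (k ^+ 2 * ((- k' * q') ^+ 2 + q' ^+ 2)); last by rewrite u' mulr1.
    by transitivity (((k * k') ^+ 2 + k ^+ 2) * q' ^+ 2); [rewrite kk|]; ring.
  transitivity (k ^+ 2 * ((- k * q) ^+ 2 + q ^+ 2)); last by ring.
  by rewrite u mulr1.
have kqE : k * q * (k' * q') = - (q * q') by rewrite mulrACA kk; ring.
have {q'E} : q' = `|k| * q.
  apply/eqP; rewrite -(eqrXn2 (n :=
    2)) ?mulr_ge0 // ?ltW // q'E !exprMn real_normK ?num_real //.
case: ltrgt0P kk => [k0|k0|->] kk q'E; last by exfalso; lra.
  have E : k' * q' = - q by rewrite q'E; nra.
  apply/eqP; rewrite expr1 eq_complex /=; simpc.
  by apply/andP; split; apply/eqP; lra.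
have E : k' * q' = q by rewrite q'E; nra.
apply/eqP; rewrite expr0 eq_complex /=; simpc.
by apply/andP; split; apply/eqP; lra.
Qed.

Lemma unimodV x : unimod x -> x * x^*%C = 1.
Proof.
by case: x => a b; rewrite /unimod /= => u; apply/eqP; rewrite eq_complex /=; simpc;
  apply/andP; split; apply/eqP; lra.
Qed.

(** A square root with positive real part has its argument in ]-pi/2, pi/2[, so it is the one given
    by half of [carg]; the sign of its imaginary part selects [acos] or its opposite. *)
Lemma cexpi_carg (x rho : R[i]) (r : R) : unimod rho -> 0 < complex.Re rho -> 0 < r ->
  x = r%:C * rho ^+ 2 -> cexpi (carg x / 2) = rho /\ - pi <= carg x <= pi.
Proof.
case: rho => c s; rewrite /unimod /= => u c0 r0 ->.
have nE : Normc.normc (r%:C * (c +i* s) ^+ 2) = r.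
  rewrite Normc.normcM expr2 Normc.normcM /= u sqrtr1 !mulr1 expr0n addr0 sqrtr_sqr
    gtr0_norm //.
have reE : complex.Re (r%:C * (c +i* s) ^+ 2) / r = 2 * c ^+ 2 - 1.
  rewrite expr2 /= mul0r subr0 mulrAC mulfV ?gt_eqF // mul1r; lra.
have imE : (0 <= complex.Im (r%:C * (c +i* s) ^+ 2)) = (0 <= s).
  rewrite expr2 /= mul0r addr0; have -> : r * (c * s + s * c) = (r * c * 2) * s by ring.
  by rewrite pmulr_rge0 // !mulr_gt0.
rewrite /carg nE reE imE /cexpi.
have c1 : c ^+ 2 <= 1 by nra.
have b1 : -1 <= 2 * c ^+ 2 - 1 <= 1 by nra.
set t := acos _.
have ct : cos t = 2 * c ^+ 2 - 1 by rewrite /t acosK // in_itv.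
have t0 : 0 <= t by apply: acos_ge0.
have tpi : t <= pi by apply: acos_lepi.
have p0 := @pi_gt0 R.
have ch : cos (t / 2) = c.
  have c0' : 0 <= cos (t / 2) by apply: cos_ge0_pihalf; apply/andP; split; lra.
  apply/eqP; rewrite -(eqrXn2 (n := 2)) // ?ltW //; apply/eqP.
  have : cos (t / 2 + t / 2) = 2 * c ^+ 2 - 1 by rewrite -splitr.
  by rewrite cosD -!expr2 sin2cos2 => ?; lra.
have sh : sin (t / 2) = `|s|.
  have s0' : 0 <= sin (t / 2) by apply: sin_ge0_pi; apply/andP; split; lra.
  apply/eqP; rewrite -(eqrXn2 (n := 2)) //; apply/eqP.
  by rewrite sin2cos2 ch real_normK ?num_real //; lra.
case: (lerP 0 s) => s0.
  by rewrite ch sh ger0_norm //; split=> //; apply/andP; split; lra.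
by rewrite mulNr cosN sinN ch sh ltr0_norm // opprK; split=> //; apply/andP; split; lra.
Qed.

(** As [hroot] has positive imaginary part, the signs of both coordinates become algebraic
    conditions on the values of [kap]. *)
Lemma hroot_mul v w : hroot w * (hroot v)^*%C =
  (complex.Im (hroot v) * complex.Im (hroot w) * (1 + kap v * kap w)) +i*
  (complex.Im (hroot v) * complex.Im (hroot w) * (kap w - kap v)).
Proof.
have := hroot_Re v; have := hroot_Re w.
move: (kap v) (hroot v) (kap w) (hroot w) => k [p q] k' [p' q'] /= -> ->.
by apply/eqP; rewrite eq_complex /=; simpc; apply/andP; split; apply/eqP; ring.
Qed.

Lemma unimodM x y : unimod x -> unimod y -> unimod (x * y).
Proof.
case: x y => a b [c d]; rewrite /unimod /= => x1 y1.
transitivity ((a ^+ 2 + b ^+ 2) * (c ^+ 2 + d ^+ 2)); first by ring.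
by rewrite x1 y1 mulr1.
Qed.

Lemma unimodJ x : unimod x -> unimod x^*%C.
Proof. by case: x => a b; rewrite /unimod /= sqrrN. Qed.

Lemma unimod_i : unimod 'i%C.
Proof. by rewrite /unimod /=; ring. Qed.

Lemma unimod_sign (b : bool) : unimod ((-1) ^+ b).
Proof. by case: b; rewrite /unimod /=; ring. Qed.

(* e^(i t / 2), where t is the turn between arriving along - v and leaving
   along w. *)
Definition turn_root v w : R[i] :=
  (-1) ^+ (kap v < kap w)%R * 'i%C * (hroot w * (hroot v)^*%C).

Lemma turn_root_unimod v w : unimod (turn_root v w).
Proof.
apply: unimodM; first by apply: unimodM; [apply: unimod_sign | apply: unimod_i].
by apply: unimodM; [apply: hroot_unimod | apply/unimodJ/hroot_unimod].
Qed.

(** The sign in [turn_root] is the one that makes its real part positive, so [cexpi_carg] applies.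
    The factor [t] absorbs the lengths of the segments. *)
Lemma turn_rootP v w (t : R) : complex.Im v != 0 -> complex.Im w != 0 ->
    kap v != kap w -> 0 < t ->
  cexpi (carg (t%:C * (w / - v)) / 2) =
    turn_root v w /\ - pi <= carg (t%:C * (w / - v)) <= pi.
Proof.
move=> v0 w0 vw t0.
have n0 x : complex.Im x != 0 -> 0 < Normc.normc x.
  by move=> /normc_gt_Re; apply: le_lt_trans; apply: normr_ge0.
apply: (@cexpi_carg _ _ (t * (Normc.normc w / Normc.normc v))).
- exact: turn_root_unimod.
- rewrite /turn_root hroot_mul.
  have := mulr_gt0 (hroot_Im_gt0 v) (hroot_Im_gt0 w); set q := _ * _ => q0.
  case: (ltgtP (kap v) (kap w)) vw => // vw _; rewrite ?expr0 ?expr1 ?mulN1r ?mul1r /=.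
    by have := mulr_gt0 q0 (_ : 0 < kap w - kap v); rewrite subr_gt0 vw => /(_ isT);
      lra.
  by have := mulr_gt0 q0 (_ : 0 < kap v - kap w); rewrite subr_gt0 vw => /(_ isT); lra.
- by rewrite mulr_gt0 ?divr_gt0 ?n0.
rewrite /turn_root !exprMn -exprM mulnC exprM sqrrN expr1n expr1n mul1r sqr_i.
have h1 := unimodV (hroot_unimod v).
have h0 : hroot v != 0.
  by apply/eqP=> h0; move: h1; rewrite h0 mul0r => /eqP; rewrite eq_sym oner_eq0.
have -> : (hroot v)^*%C = (hroot v)^-1 by apply: (mulfI h0); rewrite h1 mulfV.
rewrite {1}(hrootE v0) {1}(hrootE w0) !rmorphM /= fmorphV /=.
by field; rewrite h0 /= -(rmorph0 (real_complex R)) (inj_eq (@complexI R)) gt_eqF // n0.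
Qed.

Lemma cexpiD (s t : R) : cexpi (s + t) = cexpi s * cexpi t.
Proof. by rewrite /cexpi cosD sinD [X in _ +i* X]addrC; simpc. Qed.

Lemma cexpiN (t : R) : cexpi (- t) = (cexpi t)^*%C.
Proof. by rewrite /cexpi cosN sinN. Qed.

(* Among the directions w', the one that maximizes the turn after v is, in the
   order of kap, the last one before v, or the last one if none is before v. *)
Lemma turn_max v w w' : complex.Im v != 0 -> complex.Im w != 0 -> complex.Im w' != 0 ->
    kap v != kap w -> kap v != kap w' -> kap w != kap w' ->
    carg (w' / - v) <= carg (w / - v) ->
  (kap w' < kap w) (+) (kap w' < kap v) = (kap v < kap w).
Proof.
move=> v0 w0 w'0 vw vw' ww' le.
have [] := turn_rootP v0 w0 vw ltr01; have [] := turn_rootP v0 w'0 vw' ltr01.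
rewrite !mul1r => e' /andP[b1' b2'] e /andP[b1 b2].
(* Both turns lie in [-pi, pi], so half of their difference lies in [0, pi], where the sine is
   nonnegative. *)
have : 0 <= complex.Im (turn_root v w * (turn_root v w')^*%C).
  rewrite -e -e' -cexpiN -cexpiD /=; apply: sin_ge0_pi; apply/andP; split; lra.
have -> : turn_root v w * (turn_root v w')^*%C =
   (-1) ^+ ((kap v < kap w)%R (+) (kap v < kap w')%R) * (hroot w * (hroot w')^*%C).
  have h1 := unimodV (hroot_unimod v).
  rewrite /turn_root signr_addb !conjM conj_sign conjK.
  transitivity ((-1) ^+ (kap v < kap w)%R * (-1) ^+ (kap v < kap w')%R * (hroot w *
    (hroot w')^*%C)
   * ('i%C * ('i%C)^*%C) * (hroot v * (hroot v)^*%C)); first by ring.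
  by rewrite h1 (unimodV unimod_i) !mulr1.
rewrite hroot_mul; have := mulr_gt0 (hroot_Im_gt0 w') (hroot_Im_gt0 w);
  set q := _ * _ => q0.
by case: (ltgtP (kap v) (kap w)) vw => // vw _;
  case: (ltgtP (kap v) (kap w')) vw' => // vw' _;
  case: (ltgtP (kap w) (kap w')) ww' => // ww' _;
  rewrite /= ?expr0 ?expr1 ?mulN1r ?mul1r /=; nra.
Qed.

End HalfAngle.

(** * Sectors, corner angles and projections *)

Section Corner.
Variable R : realType.
Implicit Types (v w x y : R[i]).

Lemma normc_gt0 v : complex.Im v != 0 -> 0 < Normc.normc v.
Proof.
move=> v0; rewrite lt_neqAle normc_ge0 andbT eq_sym; apply: contra_neq v0.
by move=> /Normc.eq0_normc ->.
Qed.

(** Up to the product of the moduli, [cross v w] is the imaginary part of z^2, hence 2 Re z Im z,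
    where z is [hroot w] times the conjugate of [hroot v]. *)
Lemma cross_kap v w : complex.Im v != 0 -> complex.Im w != 0 ->
  exists2 r : R, 0 < r & cross v w = r * ((1 + kap v * kap w) * (kap w - kap v)).
Proof.
move=> v0 w0.
exists (2 * (complex.Im (hroot v) * complex.Im (hroot w)) ^+ 2 * (Normc.normc v *
  Normc.normc w)).
  by rewrite !mulr_gt0 ?exprn_gt0 ?mulr_gt0 ?hroot_Im_gt0 ?normc_gt0.
have -> : cross v w = complex.Im ((Normc.normc v * Normc.normc w)%:C * (hroot w *
  (hroot v)^*%C) ^+ 2).
  rewrite /cross {1}(hrootE v0) {1}(hrootE w0); congr (complex.Im _).
  have -> : ((Normc.normc v)%:C * hroot v ^+ 2)^*%C =
    (Normc.normc v)%:C * ((hroot v)^*%C) ^+ 2.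
    by rewrite expr2 !conjM conjR -expr2.
  by rewrite rmorphM /=; ring.
rewrite hroot_mul expr2 /= mul0r addr0; ring.
Qed.

(** Here [a], [b], [c] stand for values of [kap]. If [1 + a * b] is positive, the arguments of the
    first two differ by less than pi and their convex sector is the interval from [a] to [b]; if it
    is negative, the sector contains the cut and is the complement of that interval. *)
Lemma sector_order (a b c : R) : a < b -> 1 + a * b != 0 -> c != a -> c != b ->
    ~ (0 < (1 + a * c) * (c - a) * (1 + a * b) /\
       0 < (1 + c * b) * (b - c) * (1 + a * b)) ->
  (c < a) (+) (c < b) = (1 + a * b < 0).
Proof.
have pos (x y z : R) : 0 < x -> 0 < y -> 0 < z -> 0 < x * y * z by move=> *;
  rewrite !mulr_gt0.
have npn (x y z : R) : x < 0 -> 0 < y -> z < 0 -> 0 < x * y * z.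
  by move=> x0 y0 z0; rewrite -mulrA nmulr_rgt0 // pmulr_rlt0.
have pnn (x y z : R) : 0 < x -> y < 0 -> z < 0 -> 0 < x * y * z.
  by move=> x0 y0 z0; rewrite -mulrA pmulr_rgt0 // nmulr_rgt0.
move=> ab N0 ca cb out; apply/esym.
case: (ltgtP c a) ca => // ca _; case: (ltgtP c b) cb => // cb _ /=.
- apply/negbTE; rewrite -leNgt leNgt; apply/negP => N; apply: out; split.
    by apply: pnn => //; nra.
  by apply: npn => //; nra.
- by lra.
- rewrite ltNge; apply/negP => N; apply: out.
  have {}N : 0 < 1 + a * b by rewrite lt_neqAle eq_sym N0.
  by split; apply: pos => //; nra.
apply/negbTE; rewrite -leNgt leNgt; apply/negP => N; apply: out; split.
  by apply: npn => //; nra.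
by apply: pnn => //; nra.
Qed.

(* A direction y outside the sector between v and w separates v and w in the
   order of kap exactly when the cut of the argument lies in that sector. *)
Lemma kap_sector v w y : complex.Im v != 0 -> complex.Im w != 0 -> complex.Im y != 0 ->
    cross v w != 0 -> kap y != kap v -> kap y != kap w ->
    ~ (0 < cross v y * cross v w /\ 0 < cross y w * cross v w) ->
  (kap y < kap v) (+) (kap y < kap w) = (complex.Re (hroot w * (hroot v)^*%C) < 0).
Proof.
move=> v0 w0 y0 vw yv yw.
have [r r0 E] := cross_kap v0 w0; have [s s0 ->] := cross_kap v0 y0.
have [t t0 ->] := cross_kap y0 w0; move: vw; rewrite E.
have -> : (complex.Re (hroot w * (hroot v)^*%C) < 0) = (1 + kap v * kap w < 0).
  by rewrite hroot_mul /= pmulr_rlt0 // mulr_gt0 ?hroot_Im_gt0.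
move: (kap v) (kap w) (kap y) yv yw => a b c; clear - r0 s0 t0 => ca cb.
rewrite mulf_eq0 gt_eqF //= => ab.
have N0 : 1 + a * b != 0 by apply: contra_neq ab => ->; rewrite mul0r.
have {ab} : a != b by apply: contra_neq ab => ->; rewrite subrr mulr0.
rewrite neq_lt => /orP[] ab out.
  apply: sector_order => // -[h1 h2]; apply: out.
  have p (q x : R) : 0 < q -> 0 < x * (1 + a * b) ->
    0 < q * x * (r * ((1 + a * b) * (b - a))).
    move=> q0 x0; have -> : q * x * (r * ((1 + a * b) * (b - a))) =
      (q * r * (b - a)) * (x * (1 + a * b)) by ring.
    by rewrite mulr_gt0 // !mulr_gt0 // subr_gt0.
  by split; apply: p.
rewrite addbC [a * b]mulrC; apply: sector_order => //; first by rewrite mulrC.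
move=> [h1 h2]; apply: out.
have p (q x : R) : 0 < q -> 0 < - x * (1 + b * a) ->
  0 < q * x * (r * ((1 + a * b) * (b - a))).
  move=> q0 x0; have -> : q * x * (r * ((1 + a * b) * (b - a))) =
    (q * r * (a - b)) * (- x * (1 + b * a)) by ring.
  by rewrite mulr_gt0 // !mulr_gt0 // subr_gt0.
split; apply: p => //; rewrite -mulrN opprB.
  by rewrite [a * c]mulrC.
by rewrite [c * b]mulrC.
Qed.

(** Up to a positive factor, [w / v] is e^(i sg th), so the product of the roots is e^(i sg th / 2)
    up to sign. The sign depends on the cut, hence the absolute values. *)
Lemma corner_root v w (th sg : R) : complex.Im v != 0 -> complex.Im w != 0 ->
    0 < th < pi / 2 -> sg ^+ 2 = 1 -> w = v * (1 +i* (sg * tan th)) ->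
  `|complex.Re (hroot w * (hroot v)^*%C)| = cos (th / 2) /\
  `|complex.Im (hroot w * (hroot v)^*%C)| = sin (th / 2).
Proof.
move=> v0 w0 /andP[th0 th1] sg1 wE; set z := hroot w * _.
have z1 : unimod z by apply: unimodM (hroot_unimod _) (unimodJ (hroot_unimod _)).
have pi0 := @pi_gt0 R.
have c0 : 0 < cos th by apply: cos_gt0_pihalf; apply/andP; split; lra.
have mE : Normc.normc (1 +i* (sg * tan th)) = (cos th)^-1.
  rewrite /= expr1n exprMn sg1 mul1r -[X in Num.sqrt X](_ : (cos th)^-1 ^+ 2 = _).
    by rewrite sqrtr_sqr gtr0_norm // invr_gt0.
  rewrite /tan exprVn; apply: (mulIf (_ : cos th ^+ 2 != 0));
    first by rewrite sqrf_eq0 gt_eqF.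
  rewrite mulVf ?sqrf_eq0 ?gt_eqF // mulrDl mul1r exprMn exprVn divfK ?sqrf_eq0 ?gt_eqF
    //.
  by rewrite cos2Dsin2.
have : (Normc.normc w)%:C * z ^+ 2 = (Normc.normc v)%:C * (1 +i* (sg * tan th)).
  transitivity (w * (hroot v)^*%C ^+ 2).
    by rewrite {2}(hrootE w0) /z; ring.
  rewrite wE {1}(hrootE v0).
  transitivity ((Normc.normc v)%:C * (1 +i* (sg * tan th)) * (hroot v * (hroot v)^*%C)
    ^+ 2); first by ring.
  by rewrite unimodV ?expr1n ?mulr1 //; apply: hroot_unimod.
rewrite wE Normc.normcM mE => /(congr1 (@complex.Re R)).
have := normc_gt0 v0; move: (Normc.normc v : R) => n n0.
move: z z1 => [p q]; rewrite /unimod expr2 /= !mul0r !subr0 mulr1 => u e.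
have {}e : p ^+ 2 - q ^+ 2 = cos th.
  apply: (mulfI (_ : n * (cos th)^-1 != 0));
    first by rewrite mulf_neq0 ?invr_eq0 ?gt_eqF.
  by rewrite divfK ?gt_eqF // -e !expr2.
have c2 : cos th = 2 * cos (th / 2) ^+ 2 - 1.
  by rewrite {1}[th]splitr cosD -!expr2 sin2cos2; ring.
have ch : 0 <= cos (th / 2) by apply: cos_ge0_pihalf; apply/andP; split; lra.
have sh : 0 <= sin (th / 2) by apply: sin_ge0_pi; apply/andP; split; lra.
split; apply/eqP; rewrite -(eqrXn2 (n := 2)) // real_normK ?num_real //; apply/eqP.
  by lra.
by rewrite sin2cos2; lra.
Qed.

Lemma ProjD x y z : Proj (x + y) z = Proj x z + Proj y z.
Proof. by rewrite /Proj rmorphD /=; ring. Qed.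

Lemma Proj0 y : Proj 0 y = 0.
Proof. by rewrite /Proj rmorph0 !mul0r addr0. Qed.

Lemma Proj_colinear (r : R) q y : y != 0 ->
  Proj (r%:C * y * q) y = r%:C * y * (complex.Re q)%:C.
Proof.
move=> y0; rewrite /Proj !conjM conjR sqr_normc ReJ_add.
have yJ : y^*%C != 0 by rewrite conjc_eq0.
by field; rewrite y0 yJ.
Qed.

End Corner.

(** * Edges and faces of the tiling *)

Section Cross.
Variable R : realType.
Implicit Types (p q u v w x y z : R[i]) (r t : R).

Lemma crossE x y : cross x y =
  complex.Re x * complex.Im y - complex.Im x * complex.Re y.
Proof. by case: x y => a b [c d]; rewrite /cross /= mulNr. Qed.

Lemma crossDr x y z : cross x (y + z) = cross x y + cross x z.
Proof. by case: x y z => a b [c d] [e f]; rewrite !crossE /=; ring. Qed.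

Lemma crossNr x y : cross x (- y) = - cross x y.
Proof. by case: x y => a b [c d]; rewrite !crossE /=; ring. Qed.

Lemma crossC x y : cross y x = - cross x y.
Proof. by case: x y => a b [c d]; rewrite !crossE /=; ring. Qed.

Lemma crossxx x : cross x x = 0.
Proof. by case: x => a b; rewrite !crossE /=; ring. Qed.

Lemma crossZr r x y : cross x (r%:C * y) = r * cross x y.
Proof. by case: x y => a b [c d]; rewrite !crossE /=; ring. Qed.

Lemma crossZl r x y : cross (r%:C * x) y = r * cross x y.
Proof. by rewrite crossC crossZr [cross y x]crossC; ring. Qed.

Lemma crossNl x y : cross (- x) y = - cross x y.
Proof. by rewrite crossC crossNr opprK crossC. Qed.

Lemma realCD r t : (r + t)%:C = r%:C + t%:C :> R[i]. Proof. exact: rmorphD. Qed.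
Lemma realCM r t : (r * t)%:C = r%:C * t%:C :> R[i]. Proof. exact: rmorphM. Qed.
Lemma realCN r : (- r)%:C = - r%:C :> R[i]. Proof. exact: rmorphN. Qed.
Lemma realC1 : 1%:C = 1 :> R[i]. Proof. by []. Qed.

(** Cramer's rule in the basis [x], [y]. *)
Lemma cross_decomp x y z : cross x y != 0 ->
  z = (cross z y / cross x y)%:C * x + (cross x z / cross x y)%:C * y.
Proof.
case: x y z => a b [c d] [e f]; rewrite !crossE /= => n0.
by apply/eqP; rewrite eq_complex /=; apply/andP; split; apply/eqP; field.
Qed.

(** Finitely many strict inequalities survive a common small perturbation. *)
Lemma seq_small (s : seq R[i]) (f g : R[i] -> R) :
    (forall p, p \in s -> 0 < f p) ->
  exists2 e0, 0 < e0 & forall e, 0 < e <= e0 -> forall p, p \in s -> 0 < f p + e * g p.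
Proof.
elim: s => [|p s IH] sP; first by exists 1.
case: IH => [q qs|e0 e00 IH]; first by apply: sP; rewrite inE qs orbT.
have fp : 0 < f p by apply: sP; rewrite mem_head.
have gp : 0 < `|g p| + 1 by rewrite ltr_wpDl.
exists (Num.min e0 (f p / (`|g p| + 1))); first by rewrite lt_min e00 divr_gt0.
move=> e /andP[e1]; rewrite le_min => /andP[e2]; rewrite ler_pdivlMr // => e3 q.
rewrite inE => /orP[/eqP->|]; last by apply: IH; rewrite e1.
have : - `|g p| <= g p by rewrite lerNl -normrN ler_norm.
nra.
Qed.

Lemma closed_open_combination (s : seq R[i]) p q w (a b c : R) :
    closed_polygon s p -> closed_polygon s q -> open_polygon s w ->
    0 <= a -> 0 <= b -> 0 < c -> a + b + c = 1 ->
  open_polygon s (a%:C * p + b%:C * q + c%:C * w).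
Proof.
move=> sp sq sw a0 b0 c0 abc r rs.
have -> : a%:C * p + b%:C * q + c%:C * w - r =
    a%:C * (p - r) + b%:C * (q - r) + c%:C * (w - r).
  by rewrite -[X in _ - X]mul1r -realC1 -abc !realCD; ring.
rewrite !crossDr !crossZr; have := sp r rs; have := sq r rs; have := sw r rs.
by rewrite /=; set x := cross _ _; set y := cross _ _; set z := cross _ _ => *; nra.
Qed.

End Cross.

Section Tiling.
Variables (R : realType) (delta eta : R) (L : isoradial delta eta).
Implicit Types (p q u v w x y : R[i]) (r t : R).

Lemma side_mem (s : seq R[i]) p q : side s p q -> p \in s /\ q \in s.
Proof. by move=> [ps ->]; rewrite mem_next. Qed.

Lemma side_center w p q : white L w -> side (face L w) p q -> 0 < cross (q - p) (w - p).
Proof. by move=> Ww [pw ->]; apply: face_center. Qed.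

Lemma side_neq w p q : white L w -> side (face L w) p q -> p != q.
Proof.
move=> Ww /(side_center Ww) s0; apply/eqP => pq; move: s0; rewrite pq subrr.
by rewrite crossE /= !mul0r subrr ltxx.
Qed.

Lemma open_polygon_small w x v : open_polygon (face L w) x ->
  exists2 e0, 0 < e0 & forall e, 0 < e <= e0 -> open_polygon (face L w) (x + e%:C * v).
Proof.
move=> xw; have [e0 e00 H] := seq_small (fun p => cross (next (face L w) p - p) v) xw.
exists e0 => // e ee p pw; rewrite addrAC crossDr crossZr; exact: H.
Qed.

(** Expand [v] in the basis given by the side and the direction of the center: for small [e] the
    moved point is a convex combination of [p], [q] and [w] with positive weight on [w]. *)
Lemma side_small w p q t v : white L w -> side (face L w) p q -> 0 < t < 1 ->
    0 < cross (q - p) v ->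
  exists2 e0, 0 < e0 & forall e, 0 < e <= e0 ->
    open_polygon (face L w) (p + t%:C * (q - p) + e%:C * v).
Proof.
move=> Ww spq /andP[t0 t1] vpos; have c0 := side_center Ww spq.
have [pw qw] := side_mem spq.
rewrite [v](@cross_decomp _ (q - p) (w - p)) ?gt_eqF //.
set al := _ / _; set be := _ / _.
have be0 : 0 < be by rewrite divr_gt0.
have den : 0 < `|al| + be + 1 by have := normr_ge0 al; lra.
(* This bound keeps the weights of [p] and [q] nonnegative. *)
exists (Num.min t (1 - t) / (`|al| + be + 1)).
  by rewrite divr_gt0 // lt_min t0 subr_gt0.
move=> e /andP[e0]; rewrite ler_pdivlMr // le_min => /andP[et1 et2].
have n1 : - `|al| <= al by rewrite lerNl -normrN ler_norm.
have n2 : al <= `|al| by rewrite ler_norm.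
have -> : p + t%:C * (q - p) + e%:C * (al%:C * (q - p) + be%:C * (w - p)) =
  (1 - t - e * al - e * be)%:C * p + (t + e * al)%:C * q + (e * be)%:C * w.
  by rewrite !(realCD, realCN, realCM, realC1); ring.
apply: closed_open_combination;
  [exact: face_convex|exact: face_convex|exact: face_center|nra|nra|nra|ring].
Qed.

Lemma same_face w w' x : white L w -> white L w' ->
  open_polygon (face L w) x -> open_polygon (face L w') x -> w = w'.
Proof.
move=> Ww Ww' xw xw'; apply/eqP/negPn/negP => ww'.
by have := face_disjoint Ww Ww' ww'; rewrite -subset0 => /(_ x); apply.
Qed.

Definition graph_edge p q : Prop := exists wl wr,
  [/\ white L wl, white L wr, side (face L wl) p q & side (face L wr) q p].

Lemma graph_edge_neq p q : graph_edge p q -> p != q.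
Proof. by move=> [wl [wr [Wl _ s _]]]; apply: side_neq s. Qed.

Lemma sides_neq wl wr p q : white L wl -> white L wr ->
  side (face L wl) p q -> side (face L wr) q p -> wl != wr.
Proof.
move=> Wl Wr /(side_center Wl) sl /(side_center Wr) sr; apply/eqP=> lr.
move: sl sr; rewrite lr; case: p q wr {lr Wr} => a b [c d] [e f]; rewrite !crossE /=.
lra.
Qed.

(* Both faces of the edge would have to be the face containing x. *)
Lemma edge_not_in_face p q t w : graph_edge p q -> 0 < t < 1 -> white L w ->
  ~ open_polygon (face L w) (p + t%:C * (q - p)).
Proof.
move=> [wl [wr [Wl Wr sl sr]]] t01 Ww xw.
have H w' p' q' t' : white L w' -> side (face L w') p' q' -> 0 < t' < 1 ->
    p' + t'%:C * (q' - p') = p + t%:C * (q - p) -> w' = w.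
  move=> Ww' s' t'01 xE.
  have [e0 e00 H0] := side_small Ww' s' t'01 (side_center Ww' s').
  have [e1 e10 H1] := open_polygon_small (w' - p') xw.
  have m0 : 0 < Num.min e0 e1 by rewrite lt_min e00.
  apply: (same_face Ww' Ww (H0 (Num.min e0 e1) _)); first by rewrite m0 ge_min lexx.
  by rewrite xE; apply: H1; rewrite m0 ge_min lexx orbT.
have := sides_neq Wl Wr sl sr.
rewrite (H _ _ _ _ Wl sl t01 erefl) (H _ _ _ (1 - t) Wr sr) ?eqxx //.
  by move: t01 => /andP[? ?]; apply/andP; split; lra.
by rewrite realCD realCN realC1; ring.
Qed.

(** A point strictly inside a chord is closer to the center: its squared distance drops by t (1 - t)
    |q - p|^2. *)
Lemma circle_not_between w p q t : white L w -> p \in face L w -> q \in face L w ->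
  p + t%:C * (q - p) \in face L w -> 0 < t < 1 -> p = q.
Proof.
move=> Ww pw qw uw /andP[t0 t1].
have := face_circle Ww pw; have := face_circle Ww qw; have := face_circle Ww uw.
pose sq (x : R) := x ^+ 2.
move=> /(congr1 sq) + /(congr1 sq) + /(congr1 sq); rewrite /sq !normc_sqr.
case: p q w {Ww pw qw uw} => a b [c d] [e f] /= hu hq hp.
have : t * (1 - t) * ((c - a) ^+ 2 + (d - b) ^+ 2) = 0.
  move: hu; rewrite !mul0r subr0 addr0 => hu.
  transitivity ((1 - t) * delta ^+ 2 + t * delta ^+ 2 - delta ^+ 2); last by ring.
  by rewrite -{1}hp -{1}hq -hu; ring.
move=> /eqP; rewrite mulf_eq0 gt_eqF ?mulr_gt0 ?subr_gt0 //= paddr_eq0 ?sqr_ge0 //.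
rewrite !sqrf_eq0 !subr_eq0 => /andP[/eqP ca /eqP db].
by rewrite ca db.
Qed.

(** The open segment from the vertex [u] to the center [w] lies in the open face. If it leaves the
    edge on one side, [w] is the face on that side, whose circle then meets the edge at an interior
    point. If it runs along the edge, interior points of the edge lie in an open face. *)
Lemma vertex_not_on_edge p q t w : graph_edge p q -> 0 < t < 1 -> white L w ->
  p + t%:C * (q - p) \in face L w -> False.
Proof.
move=> epq t01 Ww uw; set u := p + _ in uw.
have cen e : 0 < e <= 1 -> open_polygon (face L w) (u + e%:C * (w - u)).
  move=> /andP[e0 e1]; have -> : u + e%:C * (w - u) =
    (1 - e)%:C * u + 0%:C * u + e%:C * w.
    by rewrite !(realCD, realCN, realC1); ring.
  by apply: closed_open_combination;
    [exact: face_convex|exact: face_convex|exact: face_center|lra|lra|lra|ring].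
have H w' p' q' t' : white L w' -> side (face L w') p' q' -> 0 < t' < 1 ->
    p' + t'%:C * (q' - p') = u -> 0 < cross (q' - p') (w - u) -> False.
  move=> Ww' s' t'01 uE c0.
  have [e0 e00 H0] := side_small Ww' s' t'01 c0.
  have m0 : 0 < Num.min e0 1 by rewrite lt_min e00 ltr01.
  have ww' : w = w'.
    apply: (same_face Ww Ww' (cen (Num.min e0 1) _)).
      by rewrite m0 ge_min lexx orbT.
    by rewrite -{1}uE; apply: H0; rewrite m0 ge_min lexx.
  have [pw qw] := side_mem s'; have := side_neq Ww' s'.
  by rewrite (@circle_not_between w' p' q' t') ?eqxx // uE -ww'.
case: (epq) => wl [wr [Wl Wr sl sr]].
have [c0|c0|c0] := ltgtP 0 (cross (q - p) (w - u)).
- exact: H Wl sl t01 erefl c0.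
- apply: (H _ _ _ (1 - t) Wr sr).
  + by move: t01 => /andP[? ?]; apply/andP; split; lra.
  + by rewrite /u realCD realCN realC1; ring.
  + by rewrite -opprB crossNl oppr_gt0.
have pq := graph_edge_neq epq.
have n0 : 0 < Normc.normc (q - p) ^+ 2.
  rewrite normc_sqr; case: p q {epq u uw cen H sl sr c0 Wl Wr} pq => a b [c d].
  rewrite eq_complex negb_and /= => /orP[] h.
    by rewrite ltr_pwDl ?sqr_ge0 // exprn_even_gt0 //= subr_eq0 eq_sym.
  by rewrite ltr_wpDl ?sqr_ge0 // exprn_even_gt0 //= subr_eq0 eq_sym.
have [s sE] : exists s, w - u = s%:C * (q - p).
  exists ((complex.Re (w - u) * complex.Re (q - p) + complex.Im (w - u) * complex.Im (q
    - p)) / Normc.normc (q - p) ^+ 2).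
  move: n0 c0; rewrite normc_sqr crossE; case: (q - p) (w - u) => a b [c d] /= n0 c0.
  have adE : b * c = a * d by lra.
  apply/eqP; rewrite eq_complex /= !mul0r subr0 addr0; apply/andP; split; apply/eqP.
    apply: (mulIf (_ : a ^+ 2 + b ^+ 2 != 0));
      rewrite ?gt_eqF // mulrAC divfK ?gt_eqF //.
    have -> : c * (a ^+ 2 + b ^+ 2) = c * a * a + (b * c) * b by ring.
    by rewrite adE; ring.
  apply: (mulIf (_ : a ^+ 2 + b ^+ 2 != 0)); rewrite ?gt_eqF // mulrAC divfK ?gt_eqF //.
  have -> : d * (a ^+ 2 + b ^+ 2) = (a * d) * a + d * b * b by ring.
  by rewrite -adE; ring.
move: t01 => /andP[t0 t1].
have den : 0 < `|s| + 1 by have := normr_ge0 s; lra.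
(* Small enough for the parameter [t + e * s] to stay strictly between 0 and 1. *)
pose e := Num.min t (1 - t) / (`|s| + 1) / 2.
have m0 : 0 < Num.min t (1 - t) by rewrite lt_min t0 subr_gt0.
have e0 : 0 < e by rewrite !divr_gt0.
have eE : e * (`|s| + 1) * 2 = Num.min t (1 - t) by rewrite /e; field; rewrite gt_eqF.
have em1 : Num.min t (1 - t) <= t by rewrite ge_min lexx.
have em2 : Num.min t (1 - t) <= 1 - t by rewrite ge_min lexx orbT.
have n1 : - `|s| <= s by rewrite lerNl -normrN ler_norm.
have n2 : s <= `|s| by rewrite ler_norm.
apply: (@edge_not_in_face p q (t + e * s) w) => //; first by apply/andP; split; nra.
have := cen e; rewrite sE /u => /(_ _).
have -> : p + (t + e * s)%:C * (q - p) = p + t%:C * (q - p) + e%:C * (s%:C * (q - p)).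
  by rewrite realCD realCM; ring.
apply; apply/andP; split => //; nra.
Qed.

(** At a transversal crossing some direction points to the left of both edges, so their left faces
    coincide. Applied to both orientations of the first edge, this identifies its two faces. *)
Lemma edges_not_crossing p q t p' q' t' : graph_edge p q -> graph_edge p' q' ->
    0 < t < 1 -> 0 < t' < 1 -> p + t%:C * (q - p) = p' + t'%:C * (q' - p') ->
  cross (q - p) (q' - p') = 0.
Proof.
move=> [wl [wr [Wl Wr sl sr]]] [wl' [wr' [Wl' Wr' sl' sr']]] t01 t'01 xE.
apply/eqP/negPn/negP => c0.
have T (s : R) : 0 < s < 1 -> 0 < 1 - s < 1 by move=> /andP[? ?]; apply/andP; split;
  lra.
have H w1 p1 q1 t1 w2 p2 q2 t2 : white L w1 -> white L w2 ->
   side (face L w1) p1 q1 -> side (face L w2) p2 q2 -> 0 < t1 < 1 -> 0 < t2 < 1 ->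
   p1 + t1%:C * (q1 - p1) = p2 + t2%:C * (q2 - p2) ->
     cross (q1 - p1) (q2 - p2) != 0 -> w1 = w2.
  move=> W1 W2 s1 s2 t101 t201 E d0; set D := cross _ _ in d0.
  (* Its cross product with each of the two sides is [D * D], so it points to the left of both. *)
  pose v := D%:C * (q2 - p2) - D%:C * (q1 - p1).
  have DD : 0 < D * D by rewrite -expr2 exprn_even_gt0.
  have v1 : 0 < cross (q1 - p1) v.
    by rewrite /v crossDr crossNr !crossZr crossxx mulr0 subr0.
  have v2 : 0 < cross (q2 - p2) v.
    by rewrite /v crossDr crossNr !crossZr crossxx mulr0 add0r crossC -/D mulrN opprK.
  have [e1 e10 H1] := side_small W1 s1 t101 v1.
  have [e2 e20 H2] := side_small W2 s2 t201 v2.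
  have m0 : 0 < Num.min e1 e2 by rewrite lt_min e10.
  apply: (same_face W1 W2 (H1 (Num.min e1 e2) _)); first by rewrite m0 ge_min lexx.
  by rewrite E; apply: H2; rewrite m0 ge_min lexx orbT.
have := sides_neq Wl Wr sl sr.
have -> : wl = wl' by apply: (H wl p q t wl' p' q' t').
have -> : wr = wl'; last by rewrite eqxx.
apply: (H wr q p (1 - t) wl' p' q' t') => //; first exact: T.
  by rewrite -xE realCD realCN realC1; ring.
by rewrite -opprB crossNl oppr_eq0.
Qed.

(** An edge pointing strictly between the side towards [o] and the ray towards [w] would start
    inside the open face. *)
Lemma sector_empty w u o y : white L w -> u \in face L w -> o \in face L w ->
    graph_edge u y -> cross (o - u) (w - u) != 0 ->
  ~ (0 < cross (o - u) (y - u) * cross (o - u) (w - u) /\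
     0 < cross (y - u) (w - u) * cross (o - u) (w - u)).
Proof.
move=> Ww uw ow euy D0 [h1 h2].
have dv (x z : R) : z != 0 -> 0 < x * z -> 0 < x / z.
  move=> z0 xz; have -> : x / z = x * z * z^-1 ^+ 2 by field.
  by rewrite mulr_gt0 // exprn_even_gt0 // invr_eq0.
have := cross_decomp (y - u) D0; set ga := _ / _; set be := _ / _ => yE.
have ga0 : 0 < ga by apply: dv.
have be0 : 0 < be by apply: dv.
(* With this choice the weights of [u], [o], [w] are [e], [e * ga], [e * be], all positive. *)
pose e := (1 + ga + be)^-1.
have d0 : 0 < 1 + ga + be by lra.
have e0 : 0 < e by rewrite invr_gt0.
have eE : e * (1 + ga + be) = 1 by rewrite mulVf // gt_eqF.
apply: (@edge_not_in_face u y e w) => //; first by apply/andP; split; nra.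
rewrite yE.
have -> : u + e%:C * (ga%:C * (o - u) + be%:C * (w - u)) =
   (1 - e * ga - e * be)%:C * u + (e * ga)%:C * o + (e * be)%:C * w.
  by rewrite !(realCD, realCN, realCM, realC1); ring.
apply: closed_open_combination;
  [exact: face_convex|exact: face_convex|exact: face_center|nra|nra|nra|ring].
Qed.

End Tiling.

(** * Order of the half-edges *)

(* The a_i and b_j are the heights of the ends of two edges, k_ij compares the
   directions of the edges at the ends i and j, c_j (resp. d_i) tells that the
   first (resp. second) edge passes to the left of the end j (resp. i) of the
   other one. *)
Lemma link_cases (R : realType) (a1 a2 b1 b2 : R) (k11 k21 k12 k22 c1 c2 d1 d2 : bool) :
    a1 < a2 -> b1 < b2 ->
    (a1 < b1 -> b2 < a2 -> c1 = c2) -> (b1 < a1 -> a2 < b2 -> d1 = d2) ->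
    (a1 < b1 -> b1 < a2 -> a2 < b2 -> c1 (+) d2) ->
    (b1 < a1 -> a1 < b2 -> b2 < a2 -> d1 (+) c2) ->
    (a1 = b1 -> a2 < b2 -> k11 = d2) -> (a1 = b1 -> b2 < a2 -> ~~ k11 = c2) ->
    (a2 = b2 -> a1 < b1 -> k22 = c1) -> (a2 = b2 -> b1 < a1 -> ~~ k22 = d1) ->
    (a2 = b1 -> k21 = false) -> (a1 = b2 -> k12) -> ~ (a1 = b1 /\ a2 = b2) ->
  ((a1 < b1) || (a1 == b1) && k11) (+) ((a2 < b1) || (a2 == b1) && k21) (+)
  (((a1 < b2) || (a1 == b2) && k12) (+) ((a2 < b2) || (a2 == b2) && k22)) =
  (((a1 < b1 < a2) && c1 (+) (a1 < b2 < a2) && c2) (+)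
   ((b1 < a1 < b2) && d1 (+) (b1 < a2 < b2) && d2)) (+)
  ((a2 == b1) (+) (a1 == b2)).
Proof.
move=> ha hb nP nQ iP iQ v1 v2 v3 v4 v5 v6 v7.
have lt_cases (x y : R) : x < y ->
    [/\ (x < y) = true, (y < x) = false, (x == y) = false & (y == x) = false].
  by move=> xy; rewrite (lt_gtF xy) (lt_eqF xy) (gt_eqF xy).
have [h11|h11|h11] := ltgtP a1 b1.
- have [-> _ -> _] := lt_cases _ _ (lt_trans h11 hb).
  have [h21|h21|h21] := ltgtP a2 b1.
  + by have [-> -> -> _] := lt_cases _ _ (lt_trans h21 hb); rewrite /= ?andbF.
  + have [h22|h22|h22] := ltgtP a2 b2; rewrite /=.
    * by move: (iP h11 h21 h22); case: (c1); case: (d2).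
    * by rewrite (nP h11 h22); case: (c2).
    * by rewrite (v3 h22 h11); case: (c1).
  + have a2b2 : a2 < b2 by rewrite h21.
    by have [-> -> -> _] := lt_cases _ _ a2b2; rewrite (v5 h21) /= ?andbF.
- have [_ -> _ ->] := lt_cases _ _ (lt_trans h11 ha); rewrite (lt_trans h11 ha).
  have [h12|h12|h12] := ltgtP a1 b2.
  + have [h22|h22|h22] := ltgtP a2 b2; rewrite /=.
    * by rewrite (nQ h11 h22); case: (d2).
    * by move: (iQ h11 h12 h22); case: (d1); case: (c2).
    * by rewrite -(v4 h22 h11); case: (k22).
  + by have [-> -> _ ->] := lt_cases _ _ (lt_trans h12 ha); rewrite /= ?andbF.
  + have b2a2 : b2 < a2 by rewrite -h12.
    by have [-> -> _ ->] := lt_cases _ _ b2a2; rewrite (v6 h12) /= ?andbF.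
have a1b2 : a1 < b2 by rewrite h11.
have b1a2 : b1 < a2 by rewrite -h11.
have [-> _ -> _] := lt_cases _ _ a1b2; have [_ -> _ ->] := lt_cases _ _ b1a2.
rewrite b1a2; have [h22|h22|h22] := ltgtP a2 b2; rewrite /=.
- by rewrite (v1 h11 h22); case: (d2).
- by rewrite -(v2 h11 h22); case: (k11).
- by case: v7.
Qed.

(** * Relative position of two edges that do not cross *)

Section Darts.
Variable R : realType.
Implicit Types (p q v w x y : R[i]).

(* A dart is a base point with a direction. *)
Definition dart : Type := (R[i] * R[i])%type.

Definition dlt (d d' : dart) : bool :=
  (complex.Im d.1 < complex.Im d'.1) || (d.1 == d'.1) && (kap d.2 < kap d'.2).

Definition dart_apart (d d' : dart) : bool :=
  if d.1 == d'.1 then kap d.2 != kap d'.2 else complex.Im d.1 != complex.Im d'.1.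

Lemma dltC d d' : dart_apart d d' -> dlt d d' = ~~ dlt d' d.
Proof.
rewrite /dart_apart /dlt [d'.1 == _]eq_sym; case: eqP => [->|_].
  by rewrite ltxx /=; case: ltgtP.
by rewrite /= !orbF; case: ltgtP.
Qed.

(* The edge from p1 up to p2 passes to the left of x, at the height of x. *)
Definition left_of p1 p2 x : bool :=
  (complex.Im p1 < complex.Im x < complex.Im p2) && (cross (p2 - p1) (x - p1) < 0).

Lemma cross_param p1 p2 x : complex.Im p1 < complex.Im x < complex.Im p2 ->
  cross (p2 - p1) (x - p1) = 0 -> exists2 t, 0 < t < 1 & x = p1 + t%:C * (p2 - p1).
Proof.
case: p1 p2 x => a b [c d] [e f] /= /andP[h1 h2]; rewrite crossE /= => c0.
have db : 0 < d - b by lra.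
exists ((f - b) / (d - b)).
  by apply/andP; split; [rewrite divr_gt0 // subr_gt0 | rewrite ltr_pdivrMr // mul1r;
    lra].
apply/eqP; rewrite eq_complex /= !mul0r subr0 addr0; apply/andP; split; apply/eqP;
  last first.
  by rewrite divfK ?gt_eqF //; ring.
apply: (mulIf (_ : d - b != 0)); first by rewrite gt_eqF.
rewrite mulrDl mulrAC divfK ?gt_eqF //; lra.
Qed.

Definition no_crossing p1 p2 q1 q2 := forall t t', 0 < t < 1 -> 0 < t' < 1 ->
  p1 + t%:C * (p2 - p1) = q1 + t'%:C * (q2 - q1) -> cross (p2 - p1) (q2 - q1) = 0.

(** The cross product is affine along the second edge. A change of sign gives a zero [t], at a
    height within the range of the first edge; it is a crossing, transversal because [B] is
    nonzero. *)
Lemma no_crossing_sign p1 p2 q1 q2 (s : R) : no_crossing p1 p2 q1 q2 -> 0 < s <= 1 ->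
    complex.Im q1 < complex.Im q2 ->
    complex.Im p1 < complex.Im q1 ->
      complex.Im (q1 + s%:C * (q2 - q1)) <= complex.Im p2 ->
    cross (p2 - p1) (q1 - p1) * cross (p2 - p1) (q1 + s%:C * (q2 - q1) - p1) < 0 ->
      False.
Proof.
move=> nc /andP[s0 s1] hq h1 h2.
rewrite [q1 + _ - p1]addrAC [cross _ (q1 - p1 + _)]crossDr crossZr;
  set A := cross _ _; set B := cross _ (q2 - q1) => AB.
have B0 : B != 0.
  by apply/eqP => B0; move: AB; rewrite B0 mulr0 addr0; have := sqr_ge0 A; nra.
pose t := - A / B.
have tB : t * B = - A by rewrite /t divfK.
have B2 : 0 < B ^+ 2 by rewrite exprn_even_gt0.
have tst : 0 < t * (s - t).
  rewrite -(pmulr_lgt0 _ B2).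
  have -> : t * (s - t) * B ^+ 2 = - (- (t * B) * (- (t * B) + s * B)) by ring.
  by rewrite tB opprK oppr_gt0.
have t0 : 0 < t by nra.
have ts : t < s by nra.
have hz : complex.Im p1 < complex.Im (q1 + t%:C * (q2 - q1)) < complex.Im p2.
  move: hq h1 h2; clear -t0 ts s1;
    case: (q1) (q2) (p1) (p2) => a b [c d] [e f] [g h] /=.
  rewrite !mul0r !addr0 => hq h1 h2; have db : 0 < d - b by lra.
  by apply/andP; split; nra.
have c0 : cross (p2 - p1) (q1 + t%:C * (q2 - q1) - p1) = 0.
  by rewrite [q1 + _ - p1]addrAC [cross _ (q1 - p1 + _)]crossDr crossZr -/A -/B tB
    addrN.
have [r r01 rE] := cross_param hz c0.
have t01 : 0 < t < 1 by rewrite t0 (lt_le_trans ts s1).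
by move/eqP: B0; apply; rewrite /B (nc r t r01 t01).
Qed.

Section Sides.
Variables p1 p2 q1 q2 : R[i].
Hypothesis hp : complex.Im p1 < complex.Im p2.
Hypothesis hq : complex.Im q1 < complex.Im q2.
Hypothesis nvp : forall q t, q \in [:: q1;
  q2] -> 0 < t < 1 -> q != p1 + t%:C * (p2 - p1).
Hypothesis nvq : forall p t, p \in [:: p1;
  p2] -> 0 < t < 1 -> p != q1 + t%:C * (q2 - q1).
Hypothesis nc : no_crossing p1 p2 q1 q2.

Lemma cross_neq0 q : q \in [:: q1;
  q2] -> complex.Im p1 < complex.Im q < complex.Im p2 ->
  cross (p2 - p1) (q - p1) != 0.
Proof.
move=> qq hh; apply/eqP => c0; have [t t01 qE] := cross_param hh c0.
by have := nvp qq t01; rewrite {1}qE eqxx.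
Qed.

Let cross_neq0' p : p \in [:: p1; p2] -> complex.Im q1 < complex.Im p < complex.Im q2 ->
  cross (q2 - q1) (p - q1) != 0.
Proof.
move=> qq hh; apply/eqP => c0; have [t t01 qE] := cross_param hh c0.
by have := nvq qq t01; rewrite {1}qE eqxx.
Qed.

Lemma nested_sides : complex.Im p1 < complex.Im q1 -> complex.Im q2 < complex.Im p2 ->
  (cross (p2 - p1) (q1 - p1) < 0) = (cross (p2 - p1) (q2 - p1) < 0).
Proof.
move=> h1 h2; have := @cross_neq0 q1; have := @cross_neq0 q2.
rewrite !inE !eqxx orbT => /(_ isT) n2 /(_ isT) n1.
have {}n1 := n1 _; have {}n2 := n2 _.
have := @no_crossing_sign p1 p2 q1 q2 1 nc; rewrite ltr01 lexx mul1r addrCA subrr addr0.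
move=> /(_ isT hq h1 (ltW h2)).
have {}n1 : cross (p2 - p1) (q1 - p1) != 0 by apply: n1; rewrite h1 (lt_trans hq).
have {}n2 : cross (p2 - p1) (q2 - p1) != 0 by apply: n2; rewrite h2 (lt_trans h1).
move: (cross _ _) (cross _ _) n1 n2 => A B A0 B0 AB.
move: A0 B0; rewrite !neq_lt => /orP[] sA /orP[] sB;
  rewrite ?sA ?sB ?(lt_gtF sA) ?(lt_gtF sB) //.
  by case: AB; rewrite nmulr_rlt0.
by case: AB; rewrite pmulr_rlt0.
Qed.

(** The second edge stays on one side of the first from the height of [q1] to that of [p2]. There,
    one edge being to the left of the other means that the other is to its right. *)
Lemma interleaved_sides : complex.Im p1 < complex.Im q1 ->
  complex.Im q1 < complex.Im p2 ->
    complex.Im p2 < complex.Im q2 ->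
  (cross (p2 - p1) (q1 - p1) < 0) (+) (cross (q2 - q1) (p2 - q1) < 0).
Proof.
move=> h1 h2 h3.
have n1 : cross (p2 - p1) (q1 - p1) != 0 by apply: cross_neq0; rewrite ?inE ?eqxx // h1.
have n2 : cross (q2 - q1) (p2 - q1) != 0 by apply: cross_neq0';
  rewrite ?inE ?eqxx ?orbT // h2.
(* The parameter of the point of the second edge at the height of [p2]. *)
pose s := (complex.Im p2 - complex.Im q1) / (complex.Im q2 - complex.Im q1).
have d0 : 0 < complex.Im q2 - complex.Im q1 by rewrite subr_gt0.
have s01 : 0 < s <= 1.
  by apply/andP; split; [rewrite divr_gt0 // subr_gt0 | rewrite ler_pdivrMr // mul1r;
    lra].
have sE : s * (complex.Im q2 - complex.Im q1) = complex.Im p2 - complex.Im q1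
  by rewrite divfK // gt_eqF.
have hs : complex.Im (q1 + s%:C * (q2 - q1)) = complex.Im p2.
  by move: sE; clear; case: q1 q2 p2 => a b [c d] [e f] /= sE;
    rewrite mul0r addr0 sE; ring.
have := no_crossing_sign nc s01 hq h1; rewrite hs lexx => /(_ isT).
have -> : cross (p2 - p1) (q1 + s%:C * (q2 - q1) - p1) =
   - ((complex.Im p2 - complex.Im p1) * cross (q2 - q1) (p2 - q1) / (complex.Im q2 -
     complex.Im q1)).
  apply: (mulIf (_ : complex.Im q2 - complex.Im q1 != 0)); first by rewrite gt_eqF.
  rewrite mulNr divfK ?gt_eqF //.
  rewrite [q1 + _ - p1]addrAC [cross _ (q1 - p1 + _)]crossDr crossZr mulrDl mulrAC sE.
  clear; case: q1 q2 p1 p2 => a b [c d] [e f] [g h]; rewrite !crossE /=; ring.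
move: (cross _ _) (cross _ _) n1 n2 => A B A0 B0 AB.
have r0 : 0 < (complex.Im p2 - complex.Im p1) / (complex.Im q2 - complex.Im q1).
  by rewrite divr_gt0 // subr_gt0.
move: AB; rewrite mulrAC mulrN oppr_lt0 mulrCA pmulr_rgt0 // => AB.
move: A0 B0; rewrite !neq_lt => /orP[] sA /orP[] sB;
  rewrite ?sA ?sB ?(lt_gtF sA) ?(lt_gtF sB) //.
  by case: AB; rewrite nmulr_rgt0.
by case: AB; rewrite pmulr_rgt0.
Qed.

End Sides.

Lemma no_crossingC p1 p2 q1 q2 : no_crossing p1 p2 q1 q2 -> no_crossing q1 q2 p1 p2.
Proof. by move=> nc t t' t01 t'01 E; rewrite crossC (nc t' t) ?oppr0. Qed.

(** Two directions in the same open half-plane differ by less than pi, so the cut does not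
    interfere. *)
Lemma cross_up v w : 0 < complex.Im v -> 0 < complex.Im w -> (cross v w < 0) =
  (kap w < kap v).
Proof.
move=> v0 w0; have [r r0 ->] := cross_kap (lt0r_neq0 v0) (lt0r_neq0 w0).
have kv := kap_lt0 (lt0r_neq0 v0); have kw := kap_lt0 (lt0r_neq0 w0).
rewrite v0 in kv; rewrite w0 in kw.
by rewrite pmulr_rlt0 // pmulr_rlt0 ?subr_lt0 // ltr_pwDl // nmulr_rge0 // ltW.
Qed.

Lemma cross_down v w : complex.Im v < 0 -> complex.Im w < 0 -> (cross v w < 0) =
  (kap w < kap v).
Proof.
move=> v0 w0; have [r r0 ->] := cross_kap (ltr0_neq0 v0) (ltr0_neq0 w0).
have kv := kap_gt0 (ltr0_neq0 v0); have kw := kap_gt0 (ltr0_neq0 w0).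
rewrite v0 in kv; rewrite w0 in kw.
by rewrite pmulr_rlt0 // pmulr_rlt0 ?subr_lt0 // ltr_pwDl // mulr_ge0 // ltW.
Qed.

Lemma kap_up_down v w : 0 < complex.Im v -> complex.Im w < 0 -> kap v < kap w.
Proof.
move=> v0 w0; apply: (@lt_trans _ _ 0).
  by rewrite kap_lt0 ?lt0r_neq0.
by rewrite kap_gt0 ?ltr0_neq0.
Qed.

Lemma cross_rot x y z : cross (y - x) (z - x) = cross (z - y) (x - y).
Proof. by case: x y z => a b [c d] [e f]; rewrite !crossE /=; ring. Qed.

Section Link.
Variables p1 p2 q1 q2 : R[i].
Hypothesis hp : complex.Im p1 < complex.Im p2.
Hypothesis hq : complex.Im q1 < complex.Im q2.
Hypothesis pq : forall p q, p \in [:: p1; p2] -> q \in [:: q1; q2] -> p != q ->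
  complex.Im p != complex.Im q.
Hypothesis pq_neq : (p1, p2) != (q1, q2).
Hypothesis nvp : forall q t, q \in [:: q1;
  q2] -> 0 < t < 1 -> q != p1 + t%:C * (p2 - p1).
Hypothesis nvq : forall p t, p \in [:: p1;
  p2] -> 0 < t < 1 -> p != q1 + t%:C * (q2 - q1).
Hypothesis nc : no_crossing p1 p2 q1 q2.

Let P1 : dart := (p1, p2 - p1).
Let P2 : dart := (p2, p1 - p2).
Let Q1 : dart := (q1, q2 - q1).
Let Q2 : dart := (q2, q1 - q2).

Let linkP := (dlt P1 Q1 (+) dlt P2 Q1) (+) (dlt P1 Q2 (+) dlt P2 Q2).

Let leftP := ((left_of p1 p2 q1 (+) left_of p1 p2 q2) (+)
             (left_of q1 q2 p1 (+) left_of q1 q2 p2)) (+)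
             ((p2 == q1) (+) (q2 == p1)).

Let Im_eq p q : p \in [:: p1; p2] -> q \in [:: q1;
  q2] -> (p == q) = (complex.Im p == complex.Im q).
Proof.
by move=> pp qq; case: (eqVneq p q) => [->|pq'];
  rewrite ?eqxx // (negbTE (pq pp qq pq')).
Qed.

Lemma Im_sub_gt0 x y : (0 < complex.Im (x - y)) = (complex.Im y < complex.Im x).
Proof. by case: x y => a b [c d]; rewrite /= subr_gt0. Qed.

Lemma Im_sub_lt0 x y : (complex.Im (x - y) < 0) = (complex.Im x < complex.Im y).
Proof. by case: x y => a b [c d]; rewrite /= subr_lt0. Qed.

(** Generic heights reduce equality of ends to equality of heights, and [link_cases] does the
    combinatorics. Its hypotheses come from [nested_sides] and [interleaved_sides] for distinct
    ends, and from comparing directions at a common end. *)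
Lemma link_left : linkP = leftP.
Proof.
have e11 : (p1 == q1) = (complex.Im p1 == complex.Im q1) by apply: Im_eq;
  rewrite !inE eqxx ?orbT.
have e12 : (p1 == q2) = (complex.Im p1 == complex.Im q2) by apply: Im_eq;
  rewrite !inE eqxx ?orbT.
have e21 : (p2 == q1) = (complex.Im p2 == complex.Im q1) by apply: Im_eq;
  rewrite !inE eqxx ?orbT.
have e22 : (p2 == q2) = (complex.Im p2 == complex.Im q2) by apply: Im_eq;
  rewrite !inE eqxx ?orbT.
rewrite /linkP /leftP /dlt /left_of /= e11 e12 e21 e22 ![q2 == _]eq_sym e12.
have nz v w : cross v w != 0 -> 0 < complex.Im v * complex.Im w -> kap v != kap w.
  move=> c0 vw; have [v0 w0] : complex.Im v != 0 /\ complex.Im w != 0.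
    by split; apply: contraTneq vw => ->; rewrite ?mul0r ?mulr0 ltxx.
  have [r _ E] := cross_kap v0 w0; apply: contra_neq c0 => k; rewrite E k; ring.
have inE1 : p1 \in [:: p1; p2] by rewrite mem_head.
have inE2 : p2 \in [:: p1; p2] by rewrite !inE eqxx orbT.
have inF1 : q1 \in [:: q1; q2] by rewrite mem_head.
have inF2 : q2 \in [:: q1; q2] by rewrite !inE eqxx orbT.
apply: link_cases => //.
- exact: nested_sides hq nvp nc.
- exact: nested_sides hp nvq (no_crossingC nc).
- exact: interleaved_sides hp hq nvp nvq nc.
- exact: interleaved_sides hq hp nvq nvp (no_crossingC nc).
- move=> h11 _; have E : p1 = q1 by apply/eqP; rewrite e11 h11 eqxx.
  by rewrite -E cross_up // Im_sub_gt0 -?E // E.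
- move=> h11 h22; have c0 : cross (p2 - p1) (q2 - p1) != 0.
    by apply: (cross_neq0 nvp inF2); rewrite h22 h11 hq.
  have E : p1 = q1 by apply/eqP; rewrite e11 h11 eqxx.
  have u1 : 0 < complex.Im (p2 - p1) by rewrite Im_sub_gt0.
  have u2 : 0 < complex.Im (q2 - p1) by rewrite Im_sub_gt0 h11.
  rewrite cross_up // -E -leNgt lt_neqAle eq_sym (nz _ _ c0) //.
  exact: mulr_gt0.
- move=> h22 h11; have E : p2 = q2 by apply/eqP; rewrite e22 h22 eqxx.
  by rewrite cross_rot -E cross_down // Im_sub_lt0 // h22.
- move=> h22 h11; have c0 : cross (q2 - q1) (p1 - q1) != 0.
    by apply: (cross_neq0 nvq inE1); rewrite h11 -h22 hp.
  have E : p2 = q2 by apply/eqP; rewrite e22 h22 eqxx.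
  have u1 : complex.Im (p1 - p2) < 0 by rewrite Im_sub_lt0.
  have u2 : complex.Im (q1 - p2) < 0 by rewrite Im_sub_lt0 h22.
  move: c0; rewrite cross_rot -E => c0.
  rewrite cross_down // -leNgt lt_neqAle [kap (q1 - p2) == _]eq_sym (nz _ _ c0) //.
  by rewrite nmulr_rgt0.
- by move=> h21; apply/negbTE;
  rewrite -leNgt ltW // kap_up_down // ?Im_sub_gt0 // Im_sub_lt0.
- by move=> h12; apply: kap_up_down; rewrite ?Im_sub_gt0 // Im_sub_lt0.
move=> [h11 h22]; move: pq_neq; have -> : p1 = q1 by apply/eqP; rewrite e11 h11 eqxx.
have -> : p2 = q2 by apply/eqP; rewrite e22 h22 eqxx.
by rewrite eqxx.
Qed.
End Link.
End Darts.

(** * Half-edges of the domain and the sign exponent *)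

Section Domain.
Variables (R : realType) (delta eta : R) (L : isoradial delta eta).
Variable Om : spin_domain L.
Implicit Types (h g x y e : Om * bool) (F : {set Om}) (P : {set Om * bool}).

Definition opp_half h : Om * bool := (h.1, ~~ h.2).

Lemma opp_halfK : involutive opp_half.
Proof. by move=> [z b]; rewrite /opp_half /= negbK. Qed.

Lemma tip_edge y : graph_edge L (tip y) (tip (opp_half y)).
Proof.
case: y => z b; have [W1 W2 s1 s2] := tile_diamond z; case: b.
  by exists (white2 (Defs.shape z)), (white1 (Defs.shape z)).
by exists (white1 (Defs.shape z)), (white2 (Defs.shape z)).
Qed.

Lemma tip_vertex y : exists2 w, white L w & tip y \in face L w.
Proof. by have [wl [wr [Wl _ s _]]] := tip_edge y; exists wl => //;
  have [] := side_mem s. Qed.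

Lemma tip_neq y : tip y != tip (opp_half y).
Proof. exact: graph_edge_neq (tip_edge y). Qed.

Lemma tip_not_on_edge x y (t : R) : 0 < t < 1 ->
  tip x != tip y + t%:C * (tip (opp_half y) - tip y).
Proof.
move=> t01; apply/eqP => xE; have [w Ww xw] := tip_vertex x.
by apply: (vertex_not_on_edge (tip_edge y) t01 Ww); rewrite -xE.
Qed.

Lemma ctr_tip y : ctr y.1 - tip y = (tip (opp_half y) - tip y) / 2.
Proof. by case: y => z []; rewrite /ctr /tip /Defs.center /=; field. Qed.

(** The two tips determine the center, and [center_inj] the tile. *)
Lemma half_inj x y : tip x = tip y -> tip (opp_half x) = tip (opp_half y) -> x = y.
Proof.
move=> xy xy'; have ctrE z : ctr z.1 = (tip (opp_half z) + tip z) / 2 :> R[i].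
  by rewrite -[LHS](subrK (tip z)) ctr_tip; field.
have z12 : x.1 = y.1 by apply: (@center_inj _ _ _ _ Om); change (ctr x.1 = ctr y.1);
  rewrite !ctrE xy xy'.
case: x y xy z12 {xy' ctrE} => [z b] [z' b'] /= xy zz'; move: xy; rewrite -zz' => xy.
case: (eqVneq b b') => [->//|bb']; have := tip_neq (z, b).
by rewrite xy /opp_half /=; move: bb'; case: (b); case: (b') => //; rewrite eqxx.
Qed.

(** Otherwise the far end of the shorter edge would lie inside the longer one. *)
Lemma half_direction x y (t : R) : tip x = tip y -> 0 < t ->
  tip (opp_half x) - tip x = t%:C * (tip (opp_half y) - tip y) -> x = y.
Proof.
move=> xy t0 dE; case: (ltgtP t 1) => t1.
- have := @tip_not_on_edge (opp_half x) y t;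
  rewrite t0 t1 -dE xy addrC subrK eqxx => /(_ isT) //.
- have := @tip_not_on_edge (opp_half y) x t^-1;
  rewrite invr_gt0 t0 invf_lt1 // t1 => /(_ isT).
  have -> : (t^-1)%:C * (tip (opp_half x) - tip x) = tip (opp_half y) - tip y.
    by rewrite dE mulrA -realCM mulVf ?mul1r // gt_eqF.
  by rewrite xy addrC subrK eqxx.
by apply: half_inj => //; move: dE; rewrite t1 mul1r xy; apply: addIr.
Qed.

(* Multiplication by dc rotates the plane so that distinct vertices have
   distinct heights. *)
Variable dc : R[i].
Hypothesis dc_generic : forall x y, tip x != tip y ->
  complex.Im (dc * tip x) != complex.Im (dc * tip y).

Definition hdart y : dart R := (dc * tip y, dc * (tip (opp_half y) - tip y)).

Definition hlt y x := dlt (hdart y) (hdart x).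

Lemma dc_neq0 x : dc != 0.
Proof.
by apply/eqP => d0; have := dc_generic (tip_neq x); rewrite d0 !mul0r eqxx.
Qed.

Lemma hdart_base x y : ((hdart x).1 == (hdart y).1) = (tip x == tip y).
Proof.
by apply/eqP/eqP => [|/= ->//]; apply: (mulfI (dc_neq0 x)).
Qed.

Lemma hdart_Im y : complex.Im (hdart y).2 != 0.
Proof.
rewrite /= mulrBr; have := dc_generic (tip_neq y); rewrite eq_sym.
by case: (dc * _) (dc * _) => [a b] [c d] /=; rewrite subr_eq0.
Qed.

(** By [hrootE] a vector is its modulus times a function of [kap]. *)
Lemma kap_eq (v w : R[i]) : complex.Im v != 0 -> complex.Im w != 0 -> kap v = kap w ->
  exists2 t : R, 0 < t & v = t%:C * w.
Proof.
move=> v0 w0 k; exists (Normc.normc v / Normc.normc w);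
  first by rewrite divr_gt0 ?normc_gt0.
transitivity ((Normc.normc v / Normc.normc w)%:C * ((Normc.normc w)%:C * hroot w ^+
  2)); last by rewrite -hrootE.
by rewrite mulrA -realCM divfK ?gt_eqF ?normc_gt0 // {1}(hrootE v0) /hroot k.
Qed.

Lemma hdart_apart x y : x != y -> dart_apart (hdart x) (hdart y).
Proof.
move=> xy; rewrite /dart_apart hdart_base; case: eqP => [txy|/eqP txy];
  last exact: dc_generic.
apply: contra_neq xy => /(kap_eq (hdart_Im x) (hdart_Im y)) [t t0] /= dE.
apply: (half_direction txy t0); apply: (mulfI (dc_neq0 x)); rewrite dE; ring.
Qed.

Lemma hlt_total x y : x != y -> hlt x y = ~~ hlt y x.
Proof. by move=> xy; rewrite /hlt dltC // hdart_apart. Qed.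

Definition up_half (z : Om) : bool :=
  complex.Im (dc * tip (z, false)) < complex.Im (dc * tip (z, true)).

Lemma up_halfP z : complex.Im (dc * tip (z, ~~ up_half z)) < complex.Im (dc * tip (z,
  up_half z)).
Proof.
rewrite /up_half; have := dc_generic (tip_neq (z, true)); rewrite /opp_half /=.
by case: (ltgtP (complex.Im (dc * tip (z, true))) (complex.Im (dc * tip (z, false)))).
Qed.

Lemma hlink_left (z z' : Om) : z != z' ->
  let left_tip z (p : R[i]) := left_of (dc * tip (z, ~~ up_half z)) (dc * tip (z,
    up_half z)) (dc * p) in
  link hlt z z' =
  ((left_tip z (tip (z', true)) (+) left_tip z (tip (z', false))) (+)
   (left_tip z' (tip (z, true)) (+) left_tip z' (tip (z, false)))) (+)
  ((tip (z, up_half z) == tip (z', ~~ up_half z')) (+)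
   (tip (z', up_half z') == tip (z, ~~ up_half z))).
Proof.
move=> zz' left_tip.
have := @link_left R (dc * tip (z, ~~ up_half z)) (dc * tip (z, up_half z))
  (dc * tip (z', ~~ up_half z')) (dc * tip (z', up_half z')) (up_halfP z) (up_halfP z').
have mI (p q : R[i]) : (dc * p == dc * q) = (p == q)
  by rewrite (inj_eq (mulfI (dc_neq0 (z, true)))).
rewrite !mI -!mulrBr.
have opp1 (s : Om) b : tip (s, b) - tip (s, ~~ b) = tip (opp_half (s,
  ~~ b)) - tip (s, ~~ b).
  by rewrite /opp_half /= negbK.
have e1 (s : Om) b : (dc * tip (s, ~~ b), dc * (tip (s, b) - tip (s, ~~ b))) =
  hdart (s, ~~ b).
  by rewrite opp1.
have e2 (s : Om) b : (dc * tip (s, b), dc * (tip (s, ~~ b) - tip (s, b))) = hdart (s,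
  b) by [].
rewrite !e1 !e2 -!/(hlt _ _) -!/(left_tip _ _).
have nve (s s' : Om) b b' (t : R) : 0 < t < 1 ->
    dc * tip (s, b) != dc * tip (s', ~~ b') + t%:C * (dc * (tip (s', b') - tip (s',
      ~~ b'))).
  move=> t01; have := @tip_not_on_edge (s, b) (s', ~~ b') t t01.
  apply: contra_neq => E; apply: (mulfI (dc_neq0 (s, b)));
    rewrite E /opp_half /= negbK; ring.
have xorC (f : bool -> bool) c : f true (+) f false = f (~~ c) (+) f c.
  by case: c; rewrite //= addbC.
have -> : link hlt z z' =
    (hlt (z, ~~ up_half z) (z', ~~ up_half z') (+) hlt (z, up_half z) (z',
      ~~ up_half z')) (+)
    (hlt (z, ~~ up_half z) (z', up_half z') (+) hlt (z, up_half z) (z', up_half z')).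
  rewrite /link; case: (up_half z); case: (up_half z') => /=;
  move: (hlt _ _) (hlt _ _) (hlt _ _) (hlt _ _); by do 4!case.
rewrite (xorC (fun c => left_tip z (tip (z', c))) (up_half z')).
rewrite (xorC (fun c => left_tip z' (tip (z, c))) (up_half z)).
move=> -> //.
- move=> p q; rewrite !inE => /orP[]/eqP-> /orP[]/eqP->; rewrite mI; apply: dc_generic.
- apply: contra_neq zz' => -[/(mulfI (dc_neq0 (z, true))) h1 /(mulfI (dc_neq0 (z,
  true))) h2].
  have := @half_inj (z, up_half z) (z', up_half z') h2; rewrite /opp_half /=.
  by move=> /(_ h1) [].
- by move=> q t; rewrite !inE => /orP[]/eqP->; apply: nve.
- by move=> q t; rewrite !inE => /orP[]/eqP->; apply: nve.
move=> t t' t01 t'01 E.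
have := edges_not_crossing (tip_edge (z, ~~ up_half z)) (tip_edge (z',
  ~~ up_half z')) t01 t'01.
rewrite /opp_half /= !negbK => H.
rewrite -!mulrBr crossE.
have -> (p q : R[i]) : complex.Re (dc * p) * complex.Im (dc * q) - complex.Im (dc * p)
  * complex.Re (dc * q)
    = (complex.Re dc ^+ 2 + complex.Im dc ^+ 2) * cross p q.
  by rewrite crossE; case: dc p q => a b [c d] [e f] /=; ring.
rewrite H ?mulr0 //; apply: (mulfI (dc_neq0 (z, true))).
by move: E; rewrite -!mulrBr ![_%:C * (dc * _)]mulrCA -!mulrDr.
Qed.

Lemma hlinking_even F : even_at (@tip _ _ _ _ Om) F -> linking hlt F = odd #|F|.
Proof.
apply: (@linking_even _ _ _ hlt
  (fun z p => left_of (dc * tip (z, ~~ up_half z)) (dc * tip (z,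
    up_half z)) (dc * p)) up_half).
- by move=> z; apply: (contraTneq _ (up_halfP z)) => ->; rewrite ltxx.
- move=> z c; rewrite /left_of; case: (eqVneq c (up_half z)) => [->|];
  first by rewrite ltxx andbF.
  by case: c; case: (up_half z) => //= _; rewrite ltxx.
exact: hlink_left.
Qed.

Definition below F (k : dart R) : bool := \xor_(y in halves_of F) dlt (hdart y) k.

(* The exponent of the sign of e^(-i wind / 2) for a route from k to e inside a
   set made of the full edges F and of the final half-edge e, see route_phase. *)
Definition sgn_exp F (k e : dart R) : bool :=
  odd #|F| (+) linking hlt F (+) below F k (+) below F e (+) dlt e k.

(** The factor i accounts for the half-turn between [k.2] and the direction of travel: the first
    dart points back from its tip, whereas the route arrives there. *)
Definition phase F (k e : dart R) : R[i] :=
  (-1) ^+ sgn_exp F k e * 'i%C * (hroot k.2 * (hroot e.2)^*%C).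

Lemma belowU1 F (z : Om) k : z \notin F ->
  below (z |: F) k = (dlt (hdart (z, true)) k (+) dlt (hdart (z,
    false)) k) (+) below F k.
Proof. by move=> zF; rewrite /below !xor_halves big_setU1. Qed.

(** An edge is linked to the new one iff exactly one of its halves lies between the two halves of
    the new edge, so the new links are counted by [below]. *)
Lemma linkingU1 F g : g.1 \notin F ->
  linking hlt (g.1 |: F) =
    (below F (hdart g) (+) below F (hdart (opp_half g))) (+) linking hlt F.
Proof.
move=> gF; rewrite /linking xor_pairsU1 //; last first.
  by move=> e eF; apply: link_sym; [exact: hlt_total | apply: contraNneq gF => <-].
congr (_ (+) _).
rewrite /below -big_split /= (xor_halves F (fun y =>
  dlt (hdart y) (hdart g) (+) dlt (hdart y) (hdart (opp_half g)))).
apply: eq_bigr => e _; rewrite /link /hlt /opp_half; case: g gF => s [] _ /=;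
  move: (dlt _ _) (dlt _ _) (dlt _ _) (dlt _ _); by do 4!case.
Qed.

End Domain.

(** * Winding of the interface *)

Section Route.
Variables (R : realType) (delta eta : R) (L : isoradial delta eta).
Variable Om : spin_domain L.
Variable dc : R[i].
Hypothesis dc_generic : forall x y : Om * bool, tip x != tip y ->
  complex.Im (dc * tip x) != complex.Im (dc * tip y).
Implicit Types (h g x y e : Om * bool) (F : {set Om}) (P : {set Om * bool}).

Local Notation hdart := (hdart dc).
Local Notation sgn_exp := (sgn_exp dc).
Local Notation phase := (phase dc).
Local Notation below := (below dc).

Let dc0 x : dc != 0 := dc_neq0 dc_generic x.
Let hIm y := hdart_Im dc_generic y.

Lemma dltC_half x y : x != y -> dlt (hdart x) (hdart y) = ~~ dlt (hdart y) (hdart x).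
Proof. exact: (hlt_total dc_generic). Qed.

Lemma dlt_base (d d' k : dart R) : d'.1 = k.1 -> d.1 != k.1 -> dlt d d' = dlt d k.
Proof. by move=> E dk; rewrite /dlt E (negbTE dk). Qed.

Lemma dlt_kap (d k : dart R) : d.1 = k.1 -> dlt d k = (kap d.2 < kap k.2).
Proof. by move=> E; rewrite /dlt E ltxx eqxx. Qed.

Lemma hdart1 x y : tip x = tip y -> (hdart x).1 = (hdart y).1.
Proof. by move=> /= ->. Qed.

(** Conjugating [turn_root] changes i into - i, which reverses the comparison in the sign. *)
Lemma turn_step_root h g (t : R) : tip g = tip h -> g != h -> 0 < t ->
  cexpi (- (carg (t%:C * ((hdart g).2 / - (hdart h).2)) / 2)) =
  (-1) ^+ dlt (hdart g) (hdart h) * 'i%C * (hroot (hdart h).2 * (hroot (hdart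
    g).2)^*%C).
Proof.
move=> gh neq t0; rewrite cexpiN.
have kne : kap (hdart h).2 != kap (hdart g).2.
  by have := hdart_apart dc_generic neq;
    rewrite /dart_apart (hdart_base dc_generic) gh eqxx eq_sym.
have [-> _] := turn_rootP (hIm h) (hIm g) kne t0.
rewrite /turn_root (dlt_kap (hdart1 gh)) !conjM conj_sign conjK conj_i.
by case: (ltgtP (kap (hdart h).2) (kap (hdart g).2)) kne => // _ _;
  rewrite /= ?expr0 ?expr1; ring.
Qed.

Lemma hroot_opp g : (hroot (hdart g).2)^*%C =
  (-1) ^+ dlt (hdart (opp_half g)) (hdart g) * 'i%C * (hroot (hdart (opp_half
    g)).2)^*%C.
Proof.
have -> : (hdart (opp_half g)).2 = - (hdart g).2.
  by rewrite /= opp_halfK -mulrN opprB.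
rewrite hrootN //; congr ((-1) ^+ _ * _ * _).
rewrite /dlt (hdart_base dc_generic) eq_sym (negbTE (tip_neq g)) orbF /=.
by rewrite mulrBr; case: (dc * _) (dc * _) => a b [c d]; rewrite /= subr_lt0.
Qed.

Lemma turn_dart h g : tip g = tip h ->
  turn h g = carg ((hdart g).2 / - (hdart h).2).
Proof.
move=> gh; rewrite /turn; congr carg.
rewrite -gh ctr_tip gh -[tip h - _]opprB ctr_tip /= gh.
have n0 : tip (opp_half h) - tip h != 0 by rewrite subr_eq0 eq_sym tip_neq.
have d0 := dc0 h.
by field; rewrite n0 d0.
Qed.

(** The left-most half-edge [g] is cyclically adjacent to [h]: among the other half-edges of [P] at
    the vertex, either none lies between them, or all do when [h] comes before [g]. *)
Lemma leftmost_swap P h g y : h \notin P -> leftmost P h g -> y \in P -> y != g ->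
  dlt (hdart y) (hdart g) (+) dlt (hdart y) (hdart h) =
  (tip y == tip h) && dlt (hdart h) (hdart g).
Proof.
move=> hP /and3P[gP /eqP gh /forallP gmax] yP yg.
have [yh|yh] := eqVneq (tip y) (tip h); last first.
  rewrite (dlt_base (hdart1 gh)) ?addbb //.
  by rewrite (hdart_base dc_generic).
have kne x x' : x != x' -> tip x = tip x' -> kap (hdart x).2 != kap (hdart x').2.
  move=> xx' tx; have := hdart_apart dc_generic xx'.
  by rewrite /dart_apart (hdart_base dc_generic) tx eqxx.
have hne x : x \in P -> h != x by apply: contraTneq => <-.
rewrite /= !dlt_kap; try by apply: hdart1; rewrite ?gh ?yh.
apply: turn_max => //; try apply: kne => //; rewrite ?gh ?yh //.
- exact: hne.
- exact: hne.
- by rewrite eq_sym.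
have := gmax y; rewrite yP yh eqxx /= !turn_dart //.
Qed.

(** Besides [g] an even number of half-edges is left at the vertex, so both cases of [leftmost_swap]
    contribute 0. *)
Lemma leftmost_xor P h g : h \notin P -> leftmost P h g -> odd (degree P (tip h)) ->
  \xor_(y in P :\ g) (dlt (hdart y) (hdart g) (+) dlt (hdart y) (hdart h)) = false.
Proof.
move=> hP lm oddP; have /and3P[gP /eqP gh _] := lm.
rewrite (@xor_local _ _ (@tip _ _ _ _ Om) (tip h) (P :\ g) _ (dlt (hdart h) (hdart
  g))); last first.
  by move=> y /setD1P[yg yP]; apply: (leftmost_swap hP lm).
apply/negbTE; rewrite negb_and; apply/orP; right.
have gin : g \in [set y in P | tip y == tip h]%SET by rewrite inE gP gh eqxx.
rewrite /degree (cardsD1 g) gin add1n oddS in oddP.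
have -> : [set y in P :\ g | tip y == tip h]%SET =
  ([set y in P | tip y == tip h] :\ g)%SET.
  by apply/setP => y; rewrite !inE andbA.
exact: oddP.
Qed.

Lemma exists_leftmost P h : odd (degree P (tip h)) -> exists g, leftmost P h g.
Proof.
move=> oddP.
have [g0 /andP[g0P g0h]] : exists g, (g \in P) && (tip g == tip h).
  have : [set y in P | tip y == tip h]%SET != finset.set0.
    by apply: contraTneq oddP; rewrite /degree => ->; rewrite cards0.
  by case/set0Pn => g; rewrite inE; exists g.
pose Q := [pred g | (g \in P) && (tip g == tip h)].
have Qg0 : Q g0 by rewrite /= g0P.
case: (@Order.TotalTheory.arg_maxP _ _ _ g0 Q (turn h) Qg0) => g /andP[gP gh] gmax.
exists g; rewrite /leftmost gP gh /=; apply/forallP => y; apply/implyP; exact: gmax.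
Qed.

(* The two signs on the right are those of turn_step_root and hroot_opp. *)
Lemma sgn_exp_step F h g e : g.1 \notin F -> tip g = tip h -> h != g -> e.1 != g.1 ->
    \xor_(y in (e |: halves_of F)%SET) (dlt (hdart y) (hdart g) (+) dlt (hdart y)
      (hdart h)) = false ->
    e \notin halves_of F ->
  sgn_exp (g.1 |: F) (hdart h) (hdart e) =
  ~~ (dlt (hdart g) (hdart h) (+) dlt (hdart (opp_half g)) (hdart g)) (+)
  sgn_exp F (hdart (opp_half g)) (hdart e).
Proof.
move=> gF gh hg eg S0 eF; rewrite /sgn_exp cardsU1 gF oddD (linkingU1 dc_generic) //.
move: S0; rewrite big_setU1 //= big_split /= -!/(below F _).
have bU k : below (g.1 |: F) k =
  (dlt (hdart g) k (+) dlt (hdart (opp_half g)) k) (+) below F k.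
  by rewrite belowU1 // /opp_half; case: (g) => s [] /=; rewrite //; congr (_ (+) _);
    rewrite addbC.
rewrite !bU.
have -> : dlt (hdart (opp_half g)) (hdart h) = dlt (hdart (opp_half g)) (hdart g).
  by rewrite (dlt_base (hdart1 (esym gh))) // (hdart_base dc_generic) eq_sym tip_neq.
have -> : dlt (hdart g) (hdart e) = ~~ dlt (hdart e) (hdart g).
  by apply: dltC_half; apply: contra_neq eg => ->.
have -> : dlt (hdart (opp_half g)) (hdart e) = ~~ dlt (hdart e) (hdart (opp_half g)).
  by apply: dltC_half; apply: contra_neq eg => <-.
move: (below F _) (below F _) (below F _) (below F _) (dlt _ _) (dlt _ _) (dlt _ _)
  (dlt _ _) (dlt _ _) (odd #|F|) (linking _ F).
by do 11!case.
Qed.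

(** The planar fact enters here: for an even set, [linking] cancels the parity of the number of
    edges, so leftover loops count only through comparisons with the two ends. *)
Lemma sgn_expE F (k e : dart R) : even_at (@tip _ _ _ _ Om) F ->
  sgn_exp F k e = (\xor_(y in halves_of F) (dlt (hdart y) e (+) dlt (hdart y) k)) (+)
    dlt e k.
Proof.
move=> evF; rewrite /sgn_exp (hlinking_even dc_generic evF) addbb addFb big_split /=.
by rewrite [X in X (+) _ = _]addbC.
Qed.

Lemma realC2 : (2 : R)%:C = 2 :> R[i].
Proof. exact: (rmorph_nat (real_complex R) 2). Qed.

(** The next point [q] is the far end of the edge for [t = 1] and its center for [t = 1/2]. *)
Lemma wind_step h g (q : R[i]) (t : R) : tip g = tip h -> 0 < t ->
    q - tip h = (2 * t)%:C * (ctr g.1 - tip g) ->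
  carg ((q - tip h) / (tip h - tip (opp_half h))) =
    carg (t%:C * ((hdart g).2 / - (hdart h).2)).
Proof.
move=> gh t0 ->; congr carg; rewrite ctr_tip /= gh.
have n0 : tip (opp_half h) - tip h != 0 by rewrite subr_eq0 eq_sym tip_neq.
have n1 : tip h - tip (opp_half h) != 0 by rewrite subr_eq0 tip_neq.
have d0 := dc0 h.
rewrite realCM realC2.
by field; rewrite n0 n1 d0.
Qed.

(** Induction along the route, [n] bounding the number of half-edges left. The invariant is that the
    current tip is the only vertex of odd degree; the signs of each step are absorbed by
    [sgn_exp_step]. *)
Lemma route_phase n P F h e : P = (e |: halves_of F)%SET -> e.1 \notin F ->
  h \notin P ->
    (forall v, odd (degree P v) = (tip h == v)) -> (#|P| <= n)%N ->
  cexpi (- (wind_from (tip (opp_half h)) (tip h) (route n P h) / 2)) =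
    phase F (hdart h) (hdart e).
Proof.
elim: n P F h => [|n IH] P F h PE eF hP degP.
  by rewrite leqn0 cards_eq0 PE => /eqP/setP/(_ e); rewrite !inE eqxx.
move=> cardP; have oddP : odd (degree P (tip h)) by rewrite degP eqxx.
have eP : e \in P by rewrite PE !inE eqxx.
have e'P : opp_half e \notin P.
  rewrite PE !inE /= negb_or eF andbT; apply/eqP => ee.
  by have := tip_neq e; rewrite ee eqxx.
rewrite /=; case: pickP => [g lm|none]; last first.
  by have [g lm] := exists_leftmost oddP; have := none g; rewrite lm.
have /and3P[gP /eqP gh _] := lm.
have neq : g != h by apply: contraNneq hP => <-.
have S0 := leftmost_xor hP lm oddP.
(* The route stops exactly at [e], the only half-edge of [P] whose opposite is missing. What remains
   is then an even set. *)
rewrite -/(opp_half g); have [ge|ge] := eqVneq g e.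
  rewrite ge (negbTE e'P) /= addr0 (@wind_step h e _ 2^-1) -?ge //; last first.
  - by rewrite divff ?pnatr_eq0 // mul1r gh.
  rewrite turn_step_root //; rewrite /phase sgn_expE.
    have -> : halves_of F = (P :\ g)%SET.
      apply/setP => y; rewrite PE ge !inE; case: (eqVneq y e) => [->|//];
        by rewrite (negbTE eF).
    by rewrite S0 addFb ge.
  move=> v; have := degP v; rewrite /degree (cardsD1 e) inE eP.
  have -> : [set y in halves_of F | tip y == v]%SET =
    ([set y in P | tip y == v] :\ e)%SET.
    apply/setP => y; rewrite PE !inE; case: (eqVneq y e) => [->|//];
      by rewrite (negbTE eF).
  by rewrite -ge gh oddD; case: eqP => _ /=; case: (odd _).
have gF : g.1 \in F by move: gP; rewrite PE !inE (negbTE ge).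
have g'P : opp_half g \in P by rewrite PE !inE gF orbT.
have gg' : opp_half g != g by apply: contraTneq (tip_neq g) => ->; rewrite eqxx.
rewrite g'P /=.
pose F' := (F :\ g.1)%SET; have gF' : g.1 \notin F' by rewrite !inE eqxx.
have FE : F = (g.1 |: F')%SET by rewrite finset.setD1K.
have eg : e.1 != g.1 by apply: contraNneq eF => ->.
have PE' : (P :\ g :\ opp_half g)%SET = (e |: halves_of F')%SET.
  apply/setP => y; rewrite PE !inE; case: (eqVneq y e) => [->|ye] /=.
    rewrite !andbT; apply/andP; split; first by apply: contra_neq eg => ->.
    by apply: contra_neq eg => ->.
  case: (y.1 \in F); rewrite ?andbF ?andbT //.
  rewrite -negb_or; congr negb;
    case: y g {lm gP gh neq S0 ge gF g'P gg' F' gF' FE eg ye} => [s c] [s' c'].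
  by rewrite /opp_half !xpair_eqE /=; case: (s == s'); case: c; case: c'.
(* Removing both halves of the edge moves the odd vertex to its other end. *)
have degP' v : odd (degree (P :\ g :\ opp_half g)%SET v) = (tip (opp_half g) == v).
  have := degP v; rewrite -gh /degree.
  rewrite (cardsD1 g) (cardsD1 (opp_half g) (_ :\ _)) !inE gP g'P gg' /=.
  have -> : ([set y in P | tip y == v] :\ g :\ opp_half g)%SET =
            [set y in (P :\ g :\ opp_half g) | tip y == v]%SET.
    by apply/setP => y; rewrite !inE !andbA.
  rewrite !oddD !oddb.
  by case: (tip g == v); case: (tip (opp_half g) == v); case: (odd _).
rewrite (@wind_step h g _ 1) //; last first.
  by rewrite ctr_tip gh mulr1 realC2; field.
rewrite mulrDl opprD cexpiD turn_step_root ?ltr01 //.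
have -> : tip h = tip (opp_half (opp_half g)) by rewrite opp_halfK gh.
rewrite (IH _ F') //; last 3 first.
- by rewrite !inE (negbTE eF) andbF.
- by rewrite !inE eqxx.
- have := cardP; rewrite (cardsD1 g) gP (cardsD1 (opp_half g)) !inE gg' g'P /= => /ltnW.
  by rewrite !add1n ltnS.
rewrite /phase FE sgn_exp_step //; last 3 first.
- by rewrite eq_sym.
- move: S0; rewrite (big_setD1 (opp_half g)) ?inE ?gg' ?g'P //= PE'.
  rewrite (dlt_base (hdart1 gh)) ?addbb ?addFb // (hdart_base dc_generic) -gh.
  by rewrite eq_sym tip_neq.
- by rewrite !inE (negbTE eF) andbF.
rewrite (hroot_opp g); have := unimodV (hroot_unimod (hdart (opp_half g)).2).
move: (hroot _) (hroot _) (hroot _) (dlt _ _) (dlt _ _) (sgn_exp _ _ _) =>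
  s1 s2 s3 b1 b2 b3 h1.
transitivity ((-1) ^+ b1 * (-1) ^+ b2 * (-1) ^+ b3 * ('i%C ^+ 2) * 'i%C * (s3 * s3^*%C)
  * (s2 * s1^*%C)).
  ring.
rewrite h1 sqr_i; case: b1; case: b2; case: b3; rewrite /= ?expr0 ?expr1; ring.
Qed.

End Route.

(** * Corners *)

Section Rhombus.
Variables (R : realType) (delta eta : R) (L : isoradial delta eta).
Variable Om : spin_domain L.
Implicit Types (z : Om) (y : Om * bool).

Lemma half_angle_bounds z : 0 < half_angle z < pi / 2.
Proof.
have /andP[h1 h2] : eta <= 2 * half_angle z <= pi - eta :=
  @angle_bound _ _ _ L _ (tile_diamond z).
have e0 := eta_gt0 L; by apply/andP; split; lra.
Qed.

Lemma circle_bisector (p q w : R[i]) (r : R) : p != q ->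
    Normc.normc (p - w) = r -> Normc.normc (q - w) = r ->
  exists s : R, [/\ w - (p + q) / 2 = (0 +i* s) * ((q - p) / 2),
    r ^+ 2 = (1 + s ^+ 2) * Normc.normc ((q - p) / 2) ^+ 2 &
    cross (q - p) (w - p) = s * 2 * Normc.normc ((q - p) / 2) ^+ 2].
Proof.
move=> pq; pose sq (x : R) := x ^+ 2; pose d := (q - p) / 2; pose m := (p + q) / 2;
  pose x := w - m.
have d0 : d != 0 by rewrite mulf_neq0 ?invr_eq0 ?pnatr_eq0 // subr_eq0 eq_sym.
have -> : p - w = - d - x by rewrite /x /m /d; field.
have -> : q - w = d - x by rewrite /x /m /d; field.
have -> : cross (q - p) (w - p) = 2 * cross d x.
  have -> : q - p = (1 + 1)%:C * d by rewrite realCD realC1 /d; field.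
  have -> : w - p = x + d by rewrite /x /m /d; field.
  by rewrite crossZl crossDr crossxx addr0.
move=> /(congr1 sq) + /(congr1 sq); rewrite /sq -/d -/x !normc_sqr => e1 e2.
have n0 : complex.Re d ^+ 2 + complex.Im d ^+ 2 != 0.
  by apply: contra_neq d0; rewrite -normc_sqr => /eqP;
    rewrite sqrf_eq0 => /eqP /Normc.eq0_normc.
exists (cross d x / (complex.Re d ^+ 2 + complex.Im d ^+ 2)).
move: e1 e2 n0; rewrite !crossE; clear; case: d x => a b [e f] /= e1 e2 n0.
have dot : a * e + b * f = 0 by lra.
split; last by field.
  apply/eqP; rewrite eq_complex /= !mul0r sub0r add0r; apply/andP; split; apply/eqP.
    apply: (mulIf n0); rewrite mulNr mulrAC divfK //.
    have -> : e * (a ^+ 2 + b ^+ 2) = a * (a * e + b * f) - (a * f - b * e) * b by ring.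
    by rewrite dot mulr0 sub0r.
  apply: (mulIf n0); rewrite mulrAC divfK //.
  have -> : f * (a ^+ 2 + b ^+ 2) = b * (a * e + b * f) + (a * f - b * e) * a by ring.
  by rewrite dot mulr0 add0r.
have -> : r ^+ 2 = a ^+ 2 + b ^+ 2 + e ^+ 2 + f ^+ 2 by lra.
apply: (mulIf n0); rewrite mulrDl mulrAC.
have -> : (1 + ((a * f - b * e) / (a ^+ 2 + b ^+ 2)) ^+ 2) * (a ^+ 2 + b ^+ 2) * (a ^+
  2 + b ^+ 2) =
   (a ^+ 2 + b ^+ 2) ^+ 2 + (a * f - b * e) ^+ 2 by field.
have -> : (a * f - b * e) ^+ 2 =
  (a ^+ 2 + b ^+ 2) * (e ^+ 2 + f ^+ 2) - (a * e + b * f) ^+ 2 by ring.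
rewrite dot; ring.
Qed.

(** Both centers lie on the perpendicular bisector of the edge. Equal radii give equal distances to
    it, and the orientations of the sides give opposite signs. *)
Lemma rhombus_shape z :
  [/\ white1 (Defs.shape z) - ctr z =
        (0 +i* (- tan (half_angle z))) * ((black2 (Defs.shape z) - black1 (Defs.shape
          z)) / 2) &
      white2 (Defs.shape z) - ctr z =
        (0 +i* (tan (half_angle z))) * ((black2 (Defs.shape z) - black1 (Defs.shape z))
          / 2)].
Proof.
have [W1 W2 s1 s2] := tile_diamond z.
have [b2m b1m] := side_mem s1; have [b1m' b2m'] := side_mem s2.
have pq : black1 (Defs.shape z) != black2 (Defs.shape z) := side_neq W2 s2.
have [t1 [e1 n1 c1]] := circle_bisector pq (face_circle W1 b1m) (face_circle W1 b2m).
have [t2 [e2 n2 c2]] := circle_bisector pq (face_circle W2 b1m') (face_circle W2 b2m').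
have p1 := side_center W1 s1; have p2 := side_center W2 s2.
rewrite /half_angle /theta /ctr /Defs.center.
move: e1 n1 c1 e2 n2 c2 p1 p2 pq; clear.
move: (black1 _) (black2 _) (white1 _) (white2 _) =>
  p q w1 w2 e1 n1 c1 e2 n2 c2 p1 p2 pq.
pose N : R := Normc.normc ((q - p) / 2) ^+ 2.
have N0 : 0 < N.
  rewrite exprn_gt0 // lt_neqAle normc_ge0 andbT eq_sym;
    apply: contra_neq pq => /Normc.eq0_normc/eqP.
  by rewrite mulf_eq0 invr_eq0 pnatr_eq0 orbF subr_eq0 => /eqP.
have t2p : 0 < t2 by move: p2; rewrite c2 -/N pmulr_lgt0 // pmulr_lgt0.
have t1n : t1 < 0.
  have : cross (q - p) (w1 - p) < 0.
    move: p1; clear; case: p q w1 => a b [c d] [e f]; rewrite !crossE /=; lra.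
  by rewrite c1 -/N pmulr_llt0 // pmulr_llt0.
have t12 : t1 = - t2.
  have : t1 ^+ 2 = t2 ^+ 2.
    apply: (addrI 1); apply: (mulIf (lt0r_neq0 N0)); by rewrite -n1 -n2.
  move=> /eqP; rewrite eqf_sqr => /orP[/eqP E|/eqP//]; lra.
have -> : Normc.normc (w2 - w1) / Normc.normc (q - p) = t2.
  have -> : w2 - w1 = (0 +i* t2) * (q - p).
    have -> : w2 - w1 = (w2 - (p + q) / 2) - (w1 - (p + q) / 2) by ring.
    rewrite e1 e2 t12 -mulrBl.
    have -> : (0 +i* t2) - (0 +i* (- t2)) = (0 +i* t2) + (0 +i* t2) :> R[i].
      by apply/eqP; rewrite eq_complex /= opprK oppr0 !eqxx.
    by field.
  rewrite Normc.normcM /= expr0n add0r sqrtr_sqr gtr0_norm // mulfK //.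
  by apply: contra_neq pq => /Normc.eq0_normc/eqP; rewrite subr_eq0 => /eqP.
by rewrite atanK e1 e2 t12.
Qed.

End Rhombus.

(** * The dart of a corner compared with the half-edges *)

Section CornerDart.
Variables (R : realType) (delta eta : R) (L : isoradial delta eta).
Variable Om : spin_domain L.
Variable dc : R[i].
Hypothesis dc_generic : forall x y : Om * bool, tip x != tip y ->
  complex.Im (dc * tip x) != complex.Im (dc * tip y).
Variables u w : R[i].
Hypothesis dc_corner : complex.Im (dc * (w - u)) != 0.
Implicit Types (h g x y e : Om * bool) (F : {set Om}) (P : {set Om * bool}) (z : Om).

Local Notation hdart := (hdart dc).

Definition corner_dart : dart R := (dc * u, dc * (w - u)).

(** The sign [sg] tells on which side of the half-edge [y] the center [w] lies; the last clause puts
    [w] at angle [half_angle] from it, seen from [u]. *)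
Definition at_corner y : Prop :=
  [/\ tip y = u, white L w, u \in face L w, tip (opp_half y) \in face L w &
      exists2 sg : R, sg ^+ 2 = 1 &
        w - u = (ctr y.1 - u) * (1 +i* (sg * tan (half_angle y.1)))].

Lemma lambda_edge_corner z : lambda_edge z u w ->
  exists b, inside (z, b) /\ at_corner (z, b).
Proof.
move=> [[b ib ub] ww]; exists b; split => //.
have [W1 W2 s1 s2] := tile_diamond z.
have [m1 m2] := side_mem s1; have [m3 m4] := side_mem s2.
have ctr_u : ctr z - u =
  (if b then 1 else - 1) * ((black2 (Defs.shape z) - black1 (Defs.shape z)) / 2).
  by rewrite ub /ctr /Defs.center; case: (b); rewrite /tip /=; field.
have [E1 E2] := rhombus_shape z.
set d := _ / 2 in ctr_u E1 E2.
have aux (x : R[i]) (sg : R) : x - ctr z =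
  (0 +i* ((if b then sg else - sg) * tan (half_angle z))) * d ->
    x - u = (ctr z - u) * (1 +i* (sg * tan (half_angle z))).
  have -> : x - u = (x - ctr z) + (ctr z - u) by ring.
  have -> : 1 +i* (sg * tan (half_angle z)) =
    1 + (0 +i* (sg * tan (half_angle z))) :> R[i].
    by apply/eqP; rewrite eq_complex /= addr0 add0r !eqxx.
  move=> ->; rewrite ctr_u; case: (b); first by ring.
  have -> : 0 +i* (- sg * tan (half_angle z)) =
    - (0 +i* (sg * tan (half_angle z))) :> R[i].
    by apply/eqP; rewrite eq_complex /= oppr0 mulNr !eqxx.
  by ring.
case: ww => wz; split; rewrite ?wz ?ub //; try by case: (b).
  exists (if b then -1 else 1); first by case: (b); rewrite ?sqrrN expr1n.
  rewrite -ub; apply: aux; rewrite E1; congr ((0 +i* _) * _); case: (b); ring.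
exists (if b then 1 else -1); first by case: (b); rewrite ?sqrrN expr1n.
by rewrite -ub; apply: aux; rewrite E2; congr ((0 +i* _) * _); case: (b); ring.
Qed.

Lemma realCV2 : (2^-1 : R)%:C = 2^-1 :> R[i].
Proof. by apply: (mulfI (_ : (2 : R[i]) != 0));
  rewrite ?pnatr_eq0 // -{1}realC2 -realCM !divff ?pnatr_eq0 ?realC1. Qed.

Lemma corner_vec y : at_corner y -> exists2 sg : R, sg ^+ 2 = 1 &
  dc * (w - u) = ((2^-1)%:C * (hdart y).2) * (1 +i* (sg * tan (half_angle y.1))).
Proof.
move=> [tu _ _ _ [sg sg1 wE]]; exists sg => //; by rewrite wE -tu ctr_tip realCV2 /=;
  field.
Qed.

Let half_gt0 : 0 < 2^-1 :> R. Proof. by rewrite invr_gt0 ltr0n. Qed.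

Let hroot_half y : hroot ((2^-1)%:C * (hdart y).2) = hroot (hdart y).2.
Proof. by rewrite /hroot kapZ. Qed.

Lemma corner_roots y : at_corner y ->
  `|complex.Re (hroot corner_dart.2 * (hroot (hdart y).2)^*%C)| =
    cos (half_angle y.1 / 2) /\
  `|complex.Im (hroot corner_dart.2 * (hroot (hdart y).2)^*%C)| =
    sin (half_angle y.1 / 2).
Proof.
move=> ay; have [sg sg1 wE] := corner_vec ay; rewrite -hroot_half.
apply: (corner_root _ dc_corner (half_angle_bounds y.1) sg1 wE).
have -> (r : R) (x : R[i]) : complex.Im (r%:C * x) = r * complex.Im x.
  by case: x => p q /=; rewrite mul0r addr0.
by apply: mulf_neq0; [exact: lt0r_neq0 | exact: hdart_Im].
Qed.

Lemma corner_cross y : at_corner y -> cross (tip (opp_half y) - u) (w - u) != 0.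
Proof.
move=> [tu _ _ _ [sg sg1 ->]]; rewrite -tu ctr_tip.
have := tip_neq y; rewrite eq_sym -subr_eq0; set d := _ - _ => d0.
have -> : cross d (d / 2 * (1 +i* (sg * tan (half_angle y.1)))) =
    sg * tan (half_angle y.1) / 2 * Normc.normc d ^+ 2.
  have -> : d / 2 = (2^-1)%:C * d by rewrite realCV2 mulrC.
  rewrite -[(2^-1)%:C * d * _]mulrA crossZr normc_sqr; by case: d {d0} => p q;
    rewrite !crossE /=; field.
have /andP[th0 th1] := half_angle_bounds y.1.
have pi0 := @pi_gt0 R.
have t0 : tan (half_angle y.1) != 0.
  rewrite /tan mulf_neq0 // ?invr_eq0 gt_eqF //;
    [apply: sin_gt0_pi | apply: cos_gt0_pihalf]; apply/andP; split; lra.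
apply: mulf_neq0; last by apply: expf_neq0; apply: contra_neq d0 => /Normc.eq0_normc.
apply: mulf_neq0; last by rewrite invr_eq0 pnatr_eq0.
apply: mulf_neq0 => //; apply/eqP => s0.
by move: sg1; rewrite s0 expr0n => /eqP; rewrite eq_sym oner_eq0.
Qed.

Let crossM (p q : R[i]) : cross (dc * p) (dc * q) = Normc.normc dc ^+ 2 * cross p q.
Proof. by rewrite normc_sqr; case: (dc) p q => a b [c d] [e f]; rewrite !crossE /=;
  ring. Qed.

(** An edge leaving [u] towards [w] would enter the open face of [w]. *)
Lemma corner_apart y x : at_corner y -> dart_apart (hdart x) corner_dart.
Proof.
move=> [tu Ww uw _ _]; have base : corner_dart.1 = (hdart y).1 by rewrite /= tu.
rewrite /dart_apart base (hdart_base dc_generic).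
case: eqP => [xy|/eqP xy]; last exact: dc_generic.
apply/eqP => /esym /(kap_eq dc_corner (hdart_Im dc_generic x)) [t t0] /=.
rewrite mulrCA => /(mulfI (dc_neq0 dc_generic y)); rewrite xy tu => wE.
pose r := (1 + t)^-1.
have d0 : 0 < 1 + t by lra.
have r0 : 0 < r by rewrite invr_gt0.
have rE : r * (1 + t) = 1 by rewrite mulVf // gt_eqF.
have eux : graph_edge L u (tip (opp_half x)) by have := tip_edge x; rewrite xy tu.
apply: (@edge_not_in_face _ _ _ _ _ _ (r * t) _ eux _ Ww); first by apply/andP;
  split; nra.
have -> : u + (r * t)%:C * (tip (opp_half x) - u) =
  (1 - r)%:C * u + 0%:C * u + r%:C * w.
  rewrite realCM -mulrA -wE realCD realCN realC1; ring.
apply: closed_open_combination;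
  [exact: face_convex|exact: face_convex|exact: face_center|nra|lra|lra|lra].
Qed.

(** By [sector_empty] no edge points between [y] and the corner, so only a cut inside their sector
    can separate them from another half-edge at [u]. *)
Lemma corner_swap y x : at_corner y -> x != y ->
  dlt (hdart x) (hdart y) (+) dlt (hdart x) corner_dart =
  (tip x == u) && (complex.Re (hroot corner_dart.2 * (hroot (hdart y).2)^*%C) < 0).
Proof.
move=> ay xy; have [tu Ww uw ow _] := ay.
have base : (hdart y).1 = corner_dart.1 by rewrite /= tu.
case: (eqVneq (tip x) u) => [xu|xu]; last first.
  by rewrite (dlt_base base) ?addbb // -base (hdart_base dc_generic) tu.
have xb : (hdart x).1 = corner_dart.1 by rewrite /= xu.
have N0 : 0 < Normc.normc dc ^+ 2.
  rewrite exprn_gt0 // lt_neqAle normc_ge0 andbT eq_sym.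
  by apply: contra_neq (dc_neq0 dc_generic y) => /Normc.eq0_normc.
rewrite !dlt_kap ?xb //; apply: kap_sector.
- exact: hdart_Im.
- exact: dc_corner.
- exact: hdart_Im.
- rewrite /= tu crossM; apply: mulf_neq0; [exact: lt0r_neq0 | exact: corner_cross].
- have := hdart_apart dc_generic xy;
  rewrite /dart_apart (hdart_base dc_generic) xu tu eqxx //.
- by have := corner_apart x ay; rewrite /dart_apart xb eqxx.
have eux : graph_edge L u (tip (opp_half x)) by have := tip_edge x; rewrite xu.
have /= := sector_empty Ww uw ow eux (corner_cross ay);
  rewrite tu xu !crossM => H [h1 h2].
apply: H; split.
  by move: h1; rewrite mulrACA pmulr_rgt0 // mulr_gt0.
by move: h2; rewrite mulrACA pmulr_rgt0 // mulr_gt0.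
Qed.

Lemma corner_xor y P : at_corner y -> y \notin P ->
  \xor_(x in P) (dlt (hdart x) (hdart y) (+) dlt (hdart x) corner_dart) =
  (complex.Re (hroot corner_dart.2 * (hroot (hdart y).2)^*%C) < 0)%R && odd (degree P
    u).
Proof.
move=> ay yP; apply: (xor_local (t := @tip _ _ _ _ Om)).
by move=> x xP; apply: corner_swap => //; apply: contraNneq yP => <-.
Qed.

End CornerDart.

(** * Change of phase when the end moves to the corner *)

Section CornerPhase.
Variables (R : realType) (delta eta : R) (L : isoradial delta eta).
Variable Om : spin_domain L.
Variable dc : R[i].
Hypothesis dc_generic : forall x y : Om * bool, tip x != tip y ->
  complex.Im (dc * tip x) != complex.Im (dc * tip y).
Variables u w : R[i].
Hypothesis dc_corner : complex.Im (dc * (w - u)) != 0.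
Implicit Types (h g x y e : Om * bool) (F : {set Om}) (P : {set Om * bool}) (z : Om).

Local Notation hdart := (hdart dc).
Local Notation sgn_exp := (sgn_exp dc).
Local Notation phase := (phase dc).
Local Notation below := (below dc).
Local Notation corner := (corner_dart dc u w).
Local Notation at_corner := (@at_corner _ _ _ L Om u w).

(** The common initial direction cancels, leaving the angle between the two ends and a sign. *)
Lemma phase_mulJ F F' (k d d' : dart R) : phase F k d * (phase F' k d')^*%C =
  (-1) ^+ (sgn_exp F k d (+) sgn_exp F' k d') * (hroot d'.2 * (hroot d.2)^*%C).
Proof.
rewrite /phase signr_addb !conjM conj_sign conj_i conjK.
have h1 := unimodV (hroot_unimod k.2).
transitivity ((-1) ^+ sgn_exp F k d * (-1) ^+ sgn_exp F' k d' * (- 'i%C ^+ 2) *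
   (hroot k.2 * (hroot k.2)^*%C) * (hroot d'.2 * (hroot d.2)^*%C)); first by ring.
by rewrite h1 sqr_i opprK !mulr1.
Qed.

Lemma phase_unimod F (k d : dart R) : unimod (phase F k d).
Proof.
apply: unimodM; first by apply: unimodM; [apply: unimod_sign | apply: unimod_i].
by apply: unimodM; [apply: hroot_unimod | apply/unimodJ/hroot_unimod].
Qed.

Lemma Re_sign (b : bool) (x : R[i]) : complex.Re ((-1) ^+ b * x) =
  (-1) ^+ b * complex.Re x.
Proof. by case: b; rewrite ?expr0 ?expr1 ?mulN1r ?mul1r //; case: x. Qed.

Lemma sign_normr (b : bool) (x : R) : b = (x < 0) -> (-1) ^+ b * x = `|x|.
Proof. move=> ->; case: (ltrP x 0) => x0; first by rewrite expr1 mulN1r ltr0_norm.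
by rewrite expr0 mul1r ger0_norm. Qed.

Lemma xor_halvesU1 F h (b : pred (Om * bool)) : h \notin halves_of F ->
  \xor_(y in (h |: halves_of F)%SET) b y = b h (+) \xor_(y in halves_of F) b y.
Proof. by move=> hF; rewrite big_setU1. Qed.

(** An odd number of half-edges at [u] changes its comparison when the cut lies in the corner, which
    is exactly when the real part is negative; the sign thus produces the absolute value. *)
Lemma phase_near F h e : at_corner e -> h \notin halves_of F -> h != e ->
    e \notin halves_of F -> odd (degree (h |: halves_of F)%SET u) ->
  complex.Re (phase F (hdart h) (hdart e) * (phase F (hdart h) corner)^*%C) =
  cos (half_angle e.1 / 2).
Proof.
move=> ae hF he eF oddu;
  rewrite phase_mulJ Re_sign -(corner_roots dc_generic dc_corner ae).1.
apply: sign_normr; rewrite /sgn_exp.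
have := corner_xor dc_generic dc_corner ae (P := (h |: halves_of F)%SET).
rewrite !inE negb_or eq_sym he /= => /(_ _); rewrite inE in eF; rewrite eF => /(_ isT).
rewrite oddu andbT => <-; rewrite xor_halvesU1 // big_split /= -!/(below F _).
rewrite (dltC_half dc_generic he) (dltC (corner_apart dc_generic dc_corner h ae)).
move: (below F _) (below F _) (below F _) (dlt _ _) (dlt _ _) (odd #|F|) (linking _ F).
by do 7!case.
Qed.

(** The degree at [u] is even, so the other half-edges contribute no sign. Passing from [e] to its
    opposite half multiplies by i up to sign and turns the real part into an imaginary part, whose
    sign is given by one comparison with the corner. *)
Lemma phase_far F h e : at_corner (opp_half e) -> h \notin halves_of F -> h.1 != e.1 ->
    e.1 \notin F -> ~~ odd (degree (h |: halves_of F)%SET u) ->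
  complex.Re (phase F (hdart h) (hdart e) * (phase (e.1 |: F) (hdart h) corner)^*%C) =
  sin (half_angle e.1 / 2).
Proof.
move=> ae hF he eF evu; rewrite phase_mulJ (hroot_opp dc_generic e).
have e'e : opp_half e != e.
  by apply: contraTneq (tip_neq e) => ->; rewrite eqxx.
have := corner_xor dc_generic dc_corner ae (P := (h |: halves_of F)%SET).
rewrite !inE negb_or /= (negbTE eF) andbT (negbTE evu) andbF.
have he' : h != opp_half e by apply: contra_neq he => ->.
rewrite eq_sym he' => /(_ isT); rewrite xor_halvesU1 // big_split /= -!/(below F _).
have -> : sgn_exp F (hdart h) (hdart e) (+) sgn_exp (e.1 |: F) (hdart h) corner = 
   (dlt (hdart h) (hdart (opp_half e)) (+) dlt (hdart h) corner
      (+) (below F (hdart (opp_half e)) (+) below F corner)) (+)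
   ~~ (dlt (hdart e) (hdart (opp_half e)) (+) dlt (hdart (opp_half e)) corner).
  rewrite /sgn_exp cardsU1 eF oddD (linkingU1 dc_generic) //.
  have bU k : below (e.1 |: F) k =
    (dlt (hdart e) k (+) dlt (hdart (opp_half e)) k) (+) below F k.
    by rewrite belowU1 // /opp_half; case: (e) => s [] /=; rewrite //;
      congr (_ (+) _); rewrite addbC.
  rewrite !bU.
  rewrite (dltC_half dc_generic (_ : e != h)); last by apply: contra_neq he => ->.
  rewrite (dltC_half dc_generic (_ : opp_half e != h)); last by rewrite eq_sym.
  rewrite (dltC (corner_apart dc_generic dc_corner h ae)).
  have -> : dlt (hdart e) corner = dlt (hdart e) (hdart (opp_half e)).
    have [te _ _ _ _] := ae; rewrite (@dlt_base _ _ corner (hdart (opp_half e))) //=.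
      by rewrite te.
    by rewrite -!/((hdart _).1) (hdart_base dc_generic) tip_neq.
  move: (below F _) (below F _) (below F _) (below F _) (dlt _ _) (dlt _ _) (dlt _ _)
    (dlt _ _) (dlt _ _) (odd #|F|) (linking _ F).
  by do 11!case.
move=> ->; rewrite addFb (dltC_half dc_generic e'e) -(corner_roots dc_generic dc_corner
  ae).2.
have apt := corner_apart dc_generic dc_corner (opp_half e) ae.
have [te _ _ _ _] := ae.
have base : (hdart (opp_half e)).1 = corner.1 by rewrite /= te.
rewrite (dlt_kap base).
have kne : kap (hdart (opp_half e)).2 != kap corner.2 by move: apt;
  rewrite /dart_apart base eqxx.
set x := hroot corner.2 * (hroot (hdart (opp_half e)).2)^*%C.
have -> : hroot corner.2 * ((-1) ^+ (~~ dlt (hdart e) (hdart (opp_half e))) * 'i%C *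
   (hroot (hdart (opp_half e)).2)^*%C) =
     (-1) ^+ (~~ dlt (hdart e) (hdart (opp_half e))) * ('i%C * x).
  by rewrite /x; ring.
rewrite mulrA -signr_addb Re_sign.
have -> : complex.Re ('i%C * x) = - complex.Im x by case: x => p q /=; ring.
rewrite -normrN; apply: sign_normr;
  rewrite oppr_lt0 /x hroot_mul /= pmulr_rgt0 ?mulr_gt0 ?hroot_Im_gt0 // subr_gt0.
by case: (dlt _ _); case: (_ < _).
Qed.

(** The initial phase is 1 and the edges form loops, which contribute nothing; the factor i of
    [phase] turns the real part into the imaginary part, hence the sine. *)
Lemma phase_start F h : at_corner h -> h.1 \notin F -> even_at (@tip _ _ _ _ Om) F ->
  complex.Re (phase F (hdart h) corner)^*%C = sin (half_angle h.1 / 2).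
Proof.
move=> ah hF evF; rewrite -(corner_roots dc_generic dc_corner ah).2.
rewrite /phase !conjM conj_sign conj_i conjK sgn_expE //.
have := corner_xor dc_generic dc_corner ah (P := halves_of F).
rewrite inE hF => /(_ isT); have := evF u; rewrite -/(degree _ u) => /negbTE ->.
rewrite andbF (eq_bigr (fun y => dlt (hdart y) corner (+) dlt (hdart y) (hdart h)));
  last first.
  by move=> y _; rewrite addbC.
move=> ->; rewrite addFb.
have apt := corner_apart dc_generic dc_corner h ah.
have [te _ _ _ _] := ah.
have base : (hdart h).1 = corner.1 by rewrite /= te.
have kne : kap (hdart h).2 != kap corner.2 by move: apt; rewrite /dart_apart base eqxx.
rewrite (dlt_kap (esym base)) -mulrA Re_sign.
have -> : - 'i%C * ((hroot (hdart h).2)^*%C * hroot corner.2) =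
  - 'i%C * (hroot corner.2 * (hroot (hdart h).2)^*%C).
  by ring.
have -> (x : R[i]) : complex.Re (- 'i%C * x) = complex.Im x by case: x => p q /=; ring.
apply: sign_normr; rewrite hroot_mul /= pmulr_rlt0 ?mulr_gt0 ?hroot_Im_gt0 // subr_lt0
  //.
Qed.

End CornerPhase.

(** * Pictures and corner configurations *)

Section CornerSum.
Variables (R : realType) (delta eta : R) (L : isoradial delta eta).
Variable Om : spin_domain L.
Variable a : Om.
Hypothesis a_bdry : a \in bdry Om.
Implicit Types (h g x y e : Om * bool) (F S : {set Om}) (P : {set Om * bool}) (z : Om).

Local Notation ha := (a, true).

Lemma degreeU1 y P v : y \notin P ->
  odd (degree (y |: P)%SET v) = (tip y == v) (+) odd (degree P v).
Proof.
move=> yP; rewrite -!xor_card /degree big_setU1 //=.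
Qed.

Lemma inside_halves S y : S \subset (~: bdry Om)%SET -> y \in halves_of S -> inside y.
Proof.
by move=> /fintype.subsetP sS; rewrite inE => /sS;
  rewrite inE /inside /inside_half => ->.
Qed.

(** Parities are prescribed only at vertices of the domain; elsewhere the degree is 0. *)
Lemma degree_everywhere P (c : R[i] -> bool) :
    (forall y, y \in P -> inside y) -> (forall v, c v -> exists2 y : Om * bool,
      inside y & tip y = v) ->
    (forall y, inside y -> odd (degree P (tip y)) = c (tip y)) ->
  forall v, odd (degree P v) = c v.
Proof.
move=> iP ic H v; have [/existsP[y /andP[iy /eqP <-]]|/existsPn none] :=
  boolP [exists y : Om * bool, inside y && (tip y == v)]; first exact: H.
have -> : degree P v = 0%N.
  apply/eqP; rewrite cards_eq0; apply/eqP/setP => y; rewrite !inE.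
  apply/negP => /andP[/iP iy tv]; by have := none y; rewrite iy tv.
apply/esym/negP => /ic [y iy tv]; have := none y; by rewrite iy tv eqxx.
Qed.

Lemma halvesE z (p : picture_code Om) : z != a ->
  halves a z p = (ha |: ((z, p.2) |: halves_of p.1))%SET.
Proof.
move=> za; apply/setP => y; rewrite /halves (negbTE za) !inE.
by case: (y.1 \in p.1); case: (y == ha); case: (y == (z, p.2)).
Qed.

Lemma inside_ha : inside (ha : Om * bool).
Proof. by rewrite /inside /inside_half orbT. Qed.

(** Taking out the entering half-edge leaves its tip as the only odd vertex, as [route_phase]
    requires. *)
Lemma pictureP z (p : picture_code Om) : z != a -> is_picture a z p ->
  [/\ p.1 \subset (~: bdry Om)%SET, z \notin p.1, a \notin p.1, inside (z, p.2) &
      forall v, odd (degree ((z, p.2) |: halves_of p.1)%SET v) = (tip ha == v)].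
Proof.
move=> za /and3P[/fintype.subsetP sub]; rewrite (negbTE za) => iz /forallP deg.
have sS : p.1 \subset (~: bdry Om)%SET.
  by apply/fintype.subsetP => x /sub; rewrite !inE => /andP[].
have zS : z \notin p.1 by apply/negP => /sub; rewrite !inE eqxx.
have aS : a \notin p.1 by apply/negP => /sub; rewrite !inE a_bdry andbF.
split=> //; apply: (@degree_everywhere _ (fun v => tip ha == v)).
- by move=> y; rewrite !inE => /orP[/eqP-> //|yS]; apply: (inside_halves sS);
  rewrite inE.
- by move=> v /eqP <-; exists ha => //; exact: inside_ha.
move=> y iy; have := deg y; rewrite iy halvesE // degreeU1 /=.
  by case: (tip ha == _); case: (odd _).
by rewrite !inE negb_or /= aS andbT; apply: contra_neq za => -[].
Qed.

Lemma picture_startP (p : picture_code Om) : is_picture a a p ->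
  [/\ p.1 \subset (~: bdry Om)%SET, a \notin p.1,
    ~~ p.2 & even_at (@tip _ _ _ _ Om) p.1].
Proof.
move=> /and3P[/fintype.subsetP sub]; rewrite eqxx => p2 /forallP deg.
have sS : p.1 \subset (~: bdry Om)%SET.
  by apply/fintype.subsetP => x /sub; rewrite !inE => /andP[].
have aS : a \notin p.1 by apply/negP => /sub; rewrite !inE a_bdry andbF.
split=> // v; rewrite -/(degree _ v); apply/negbT.
apply: (@degree_everywhere _ (fun _ => false)) => //; first by move=> y;
  apply: inside_halves.
move=> y iy; have := deg y; rewrite iy /halves eqxx finset.setU0 /= => /negbTE <-.
by congr (odd (degree _ _)); apply/setP => x; rewrite !inE.
Qed.

Variable dc : R[i].
Hypothesis dc_generic : forall x y : Om * bool, tip x != tip y ->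
  complex.Im (dc * tip x) != complex.Im (dc * tip y).
Local Notation hdart := (hdart dc).
Local Notation phase := (phase dc).

Lemma interface_phase z (p : picture_code Om) : z != a -> is_picture a z p ->
  cexpi (- (wind (interface a z p) / 2)) = phase p.1 (hdart ha) (hdart (z, p.2)).
Proof.
move=> za pic; have [sS zS aS iz deg] := pictureP za pic.
rewrite /interface (negbTE za) /=.
have haP : ha \notin ((z, p.2) |: halves_of p.1)%SET.
  by rewrite !inE negb_or /= aS andbT; apply: contra_neq za => -[].
have PE : (halves a z p :\ ha)%SET = ((z, p.2) |: halves_of p.1)%SET.
  by rewrite halvesE // setU1K.
rewrite (@route_phase _ _ _ _ _ _ dc_generic _ _ p.1 ha (z, p.2)) // ?PE //.
by rewrite -PE subset_leq_card // subD1set.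
Qed.

Lemma interface_start_phase (p : picture_code Om) :
  cexpi (- (wind (interface a a p) / 2)) = 1.
Proof.
rewrite /interface eqxx /= mul0r oppr0 /cexpi cos0 sin0 //.
Qed.

Variables u w : R[i].
Hypothesis dc_corner : complex.Im (dc * (w - u)) != 0.
Local Notation corner := (corner_dart dc u w).
Local Notation at_corner := (@at_corner _ _ _ L Om u w).

(* A corner configuration joins a to the corner between u and w, with all its
   edges full; it is obtained from a picture ending at z by adding or removing
   the half of e_z at u. *)
Definition corner_config F : bool :=
  (F \subset (~: bdry Om)%SET) &&
  [forall (y : Om * bool | inside y),
    odd (degree (ha |: halves_of F)%SET (tip y)) == (tip y == u)].

Definition corner_weight F : R :=
  tan (half_angle a / 2) * \prod_(z in F) tan (half_angle z / 2).

Definition corner_sum (K : R[i]) : R[i] :=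
  \sum_(F | corner_config F) K * (corner_weight F)%:C * phase F (hdart ha) corner.

(** As [K * phik] lies on the line of [nu], the projection keeps just the real part of [phi]
    relative to [phik]. *)
Lemma Proj_phase (K nu phi phik : R[i]) (wt cw r : R) : nu != 0 -> unimod phik ->
    K * phik = r%:C * nu -> wt * complex.Re (phi * phik^*%C) = cw ->
  Proj (K * (wt%:C * phi)) nu = K * cw%:C * phik.
Proof.
move=> nu0 u1 Kk <-; have h1 := unimodV u1.
have -> : K * (wt%:C * phi) = (wt * r)%:C * nu * (phi * phik^*%C).
  transitivity (wt%:C * (K * phik) * (phi * phik^*%C)); last by rewrite Kk realCM; ring.
  by transitivity (K * (wt%:C * phi) * (phik * phik^*%C)); [rewrite h1 mulr1 | ring].
rewrite Proj_colinear // realCM.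
transitivity ((wt * complex.Re (phi * phik^*%C))%:C * (r%:C * nu));
  first by rewrite realCM; ring.
by rewrite -Kk; ring.
Qed.

Variable K nu : R[i].
Hypothesis nu_neq0 : nu != 0.
Hypothesis K_colinear : forall F, exists r : R, K * phase F (hdart ha) corner =
  r%:C * nu.

Lemma half_angle_trig z : [/\ 0 < cos (half_angle z / 2), 0 < sin (half_angle z / 2) &
  tan (half_angle z / 2) = sin (half_angle z / 2) / cos (half_angle z / 2)].
Proof.
have /andP[h1 h2] := half_angle_bounds z; have p0 := @pi_gt0 R; split => //.
  by apply: cos_gt0_pihalf; apply/andP; split; lra.
by apply: sin_gt0_pi; apply/andP; split; lra.
Qed.

(** The cosine from [phase_near] cancels the factor 1 / cos in the weight of the last half-edge. *)
Lemma Proj_picture_near z S (b : bool) : at_corner (z, b) -> z != a ->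
  is_picture a z (S, b) ->
  Proj (K * ((weight a z (S, b))%:C * cexpi (- (wind (interface a z (S, b)) / 2)))) nu =
  K * (corner_weight S)%:C * phase S (hdart ha) corner.
Proof.
move=> ac za pic; have [sS zS aS iz deg] := pictureP za pic;
  have [r Kr] := K_colinear S.
rewrite interface_phase //; apply: (Proj_phase nu_neq0 _ Kr); first exact: phase_unimod.
rewrite phase_near //.
- have [c0 s0 tE] := half_angle_trig z; rewrite /weight (negbTE za) /corner_weight /=.
  by field; exact: lt0r_neq0.
- by rewrite inE.
- by apply: contra_neq za => -[].
- by rewrite inE.
have [tu _ _ _ _] := ac; rewrite degreeU1 ?inE //.
by have := deg u; rewrite degreeU1 ?inE // tu eqxx /=; case: (odd _) => /=; case: eqP.
Qed.

(** The sine from [phase_far] over the cosine in the weight is the tangent, the weight of the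
    completed edge. *)
Lemma Proj_picture_far z S (b : bool) : at_corner (z, b) -> z != a ->
  is_picture a z (S, ~~ b) ->
  Proj (K * ((weight a z (S, ~~ b))%:C * cexpi (- (wind (interface a z (S,
    ~~ b)) / 2)))) nu =
  K * (corner_weight (z |: S)%SET)%:C * phase (z |: S)%SET (hdart ha) corner.
Proof.
move=> ac za pic; have [sS zS aS iz deg] := pictureP za pic;
  have [r Kr] := K_colinear (z |: S)%SET.
rewrite interface_phase //; apply: (Proj_phase nu_neq0 _ Kr); first exact: phase_unimod.
rewrite -[(z |: S)%SET]/((z, ~~ b).1 |: S)%SET phase_far //.
- have [c0 s0 tE] := half_angle_trig z;
  rewrite /weight (negbTE za) /corner_weight /= big_setU1 //= tE.
  by ring.
- by rewrite /opp_half /= negbK.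
- by rewrite inE.
- by rewrite eq_sym.
have [tu _ _ _ _] := ac; rewrite degreeU1 ?inE //.
have := deg u; rewrite degreeU1 ?inE //.
have -> : (tip (z, ~~ b) == u) = false.
  by apply/negbTE; rewrite -tu; have := tip_neq (z, b); rewrite eq_sym.
by case: (odd _) => /=; case: eqP.
Qed.

(** The sine from [phase_start] over the cosine in the weight is the factor of the edge at [a] in
    [corner_weight]. *)
Lemma Proj_picture_start S : at_corner ha -> is_picture a a (S, false) ->
  Proj (K * ((weight a a (S, false))%:C * cexpi (- (wind (interface a a (S,
    false)) / 2)))) nu =
  K * (corner_weight S)%:C * phase S (hdart ha) corner.
Proof.
move=> ac pic; have [sS aS _ ev] := picture_startP pic; have [r Kr] := K_colinear S.
rewrite interface_start_phase; apply: (Proj_phase nu_neq0 _ Kr);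
  first exact: phase_unimod.
rewrite mul1r phase_start //.
have [c0 s0 tE] := half_angle_trig a; rewrite /weight eqxx /corner_weight /= tE.
by ring.
Qed.

End CornerSum.

(** * Correspondence between pictures and corner configurations *)

Section Reindex.
Variables (R : realType) (delta eta : R) (L : isoradial delta eta).
Variable Om : spin_domain L.
Variable a : Om.
Hypothesis a_bdry : a \in bdry Om.
Implicit Types (h g x y e : Om * bool) (F S : {set Om}) (P : {set Om * bool}) (z : Om).

Local Notation ha := (a, true).

Lemma degree_halvesU1 z S v : z \notin S ->
  odd (degree (halves_of (z |: S)) v) =
  (tip (z, true) == v) (+) (tip (z, false) == v) (+) odd (degree (halves_of S) v).
Proof.
move=> zS; have -> : halves_of (z |: S) = ((z, true) |: ((z,
  false) |: halves_of S))%SET.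
  apply/setP => -[x c]; rewrite !inE !xpair_eqE /=.
  by case: (x == z); case: c.
by rewrite !degreeU1 ?inE ?negb_or //= ?addbA // xpair_eqE eqxx.
Qed.

Variables (z : Om) (b : bool).
Local Notation u := (tip (z, b)).

(** The half of the edge of [z] is dropped if its tip is [u], and completed to a full edge
    otherwise. *)
Definition picture_edges (p : picture_code Om) : {set Om} :=
  if p.2 == b then p.1 else (z |: p.1)%SET.

Definition edges_picture F : picture_code Om :=
  ((F :\ z)%SET, if z \in F then ~~ b else b).

Lemma edges_pictureK F : picture_edges (edges_picture F) = F.
Proof.
rewrite /picture_edges /edges_picture /=; case: (boolP (z \in F)) => zF.
  have -> : (~~ b == b) = false by case: (b).
  by rewrite finset.setD1K.
rewrite eqxx; apply/setP => y; rewrite !inE; case: eqP => [->|//];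
  by rewrite (negbTE zF).
Qed.

Lemma picture_edgesK p : (edges_picture (picture_edges p) == p) = (z \notin p.1).
Proof.
case: p => S c; rewrite /picture_edges /edges_picture /=; case: (eqVneq c b) => [->|cb].
  case: (boolP (z \in S)) => zS; last by rewrite xpair_eqE eqxx andbT;
    apply/eqP/setP => y; rewrite !inE; case: eqP => // ->; rewrite (negbTE zS).
  by rewrite xpair_eqE; case: (b); rewrite andbF.
rewrite !inE eqxx /= xpair_eqE;
  have -> : (~~ b == c) = true by case: (b) (c) cb => [] [].
rewrite andbT; case: (boolP (z \in S)) => zS.
  by apply/negbTE/eqP => /setP/(_ z); rewrite !inE eqxx zS.
by apply/eqP; rewrite setU1K.
Qed.

Lemma corner_parity (p : picture_code Om) v : z != a -> z \notin p.1 -> a \notin p.1 ->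
  (odd (degree (ha |: halves_of (picture_edges p))%SET v) == (v == u)) =
  ~~ odd (degree (halves a z p) v).
Proof.
case: p => S c /= za zS aS; rewrite halvesE // /picture_edges /=.
have h1 : ha \notin halves_of (if c == b then S else (z |: S)%SET).
  by rewrite inE /=; case: ifP => // _; rewrite !inE negb_or eq_sym za.
have h2 : ha \notin ((z, c) |: halves_of S)%SET.
  by rewrite !inE negb_or /= aS andbT; apply: contra_neq za => -[].
have h3 : (z, c) \notin halves_of S by rewrite inE.
rewrite (degreeU1 _ h1) (degreeU1 _ h2) (degreeU1 _ h3).
rewrite [v == _]eq_sym; case: (eqVneq c b) => [->|cb].
  by case: (tip ha == v); case: (u == v); case: (odd _).
rewrite degree_halvesU1 //; have -> : c = ~~ b by case: (b) (c) cb => [] [].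
by case: (b); rewrite /=; case: (tip ha == v); case: (tip (z, _) == v);
  case: (tip (z, _) == v); case: (odd _).
Qed.

Lemma is_pictureE (p : picture_code Om) : z != a -> inside (z, b) ->
  is_picture a z p =
  corner_config a u (picture_edges p) && (edges_picture (picture_edges p) == p).
Proof.
move=> za izb; rewrite picture_edgesK /is_picture (negbTE za).
have [zS|zS] := boolP (z \in p.1).
  rewrite andbF; apply/negbTE; rewrite negb_and; apply/orP; left.
  by apply/negP => /fintype.subsetP/(_ z zS); rewrite !inE eqxx.
rewrite andbT /corner_config.
have sub1 : (p.1 \subset (~: bdry Om :\ z)%SET) = (p.1 \subset (~: bdry Om)%SET).
  apply/fintype.subsetP/fintype.subsetP => H x xS; have := H x xS; rewrite !inE.
    by case/andP.
  by move=> ->; rewrite andbT; apply: contraNneq zS => <-.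
rewrite sub1; have [sS|nS] := boolP (p.1 \subset (~: bdry Om)%SET); last first.
  apply/esym/negbTE; rewrite negb_and; apply/orP; left; apply: contra nS.
  by rewrite /picture_edges; case: ifP => // _; apply: fintype.subset_trans;
    exact: finset.subsetUr.
have aS : a \notin p.1 by apply/negP => /(fintype.subsetP sS); rewrite !inE a_bdry.
(* The edge may be completed iff [z] is interior, which is also when the half away from [u] lies
   inside. *)
have -> : (picture_edges p \subset (~: bdry Om)%SET) = inside (z, p.2).
  rewrite /picture_edges; case: (eqVneq p.2 b) => [->|pb]; first by rewrite sS izb.
  rewrite finset.subUset finset.sub1set inE sS andbT; move: izb;
    rewrite /inside /inside_half /=.
  by case: (b) (p.2) pb => [] [] //=; rewrite ?orbF ?orbT.
rewrite /=; congr andb; apply: eq_forallb => y.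
by rewrite corner_parity.
Qed.

End Reindex.

Section FermionProjection.
Variables (R : realType) (delta eta : R) (L : isoradial delta eta).
Variable Om : spin_domain L.
Variable a : Om.
Hypothesis a_bdry : a \in bdry Om.
Local Notation ha := (a, true).
Variable dc : R[i].
Hypothesis dc_generic : forall x y : Om * bool, tip x != tip y ->
  complex.Im (dc * tip x) != complex.Im (dc * tip y).
Local Notation hdart := (hdart dc).
Local Notation phase := (phase dc).
Variables u w : R[i].
Hypothesis dc_corner : complex.Im (dc * (w - u)) != 0.
Local Notation corner := (corner_dart dc u w).
Variable K nu : R[i].
Hypothesis nu_neq0 : nu != 0.
Hypothesis K_colinear : forall F : {set Om}, exists r : R,
  K * phase F (hdart ha) corner = r%:C * nu.

(** The pictures ending at [z] are matched term by term with the corner configurations, so the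
    resulting sum involves only the corner. *)
Lemma Proj_picture_sum z : lambda_edge z u w ->
  Proj (K * \sum_(p | is_picture a z p) (weight a z p)%:C * cexpi (- (wind (interface a
    z p) / 2))) nu =
  corner_sum a dc u w K.
Proof.
move=> /lambda_edge_corner [b [izb ac]].
have [ub _ _ _ _] := ac.
rewrite mulr_sumr (big_morph (fun x => Proj x nu) (fun x y =>
  ProjD x y nu) (Proj0 nu)) /corner_sum.
case: (eqVneq z a) => [za|za]; last first.
  rewrite [RHS](reindex_onto (picture_edges z b) (edges_picture z b)) => [|F _];
    last exact: edges_pictureK.
  rewrite -ub; apply: eq_big => [p|[S c] pic]; first by rewrite -is_pictureE.
  have [_ zS _ _ _] := pictureP a_bdry za pic.
  rewrite ub /picture_edges /=; case: (eqVneq c b) pic => [->|cb] pic.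
    exact: Proj_picture_near.
  have cE : c = ~~ b by case: (b) (c) cb => [] [].
  by move: pic; rewrite cE => pic; exact: Proj_picture_far.
(* At [a] only the inner half has its tip in the domain, so [u] is that tip and the even edge sets
   themselves are the corner configurations. *)
have bT : b = true by move: izb; rewrite za /inside /inside_half a_bdry; case: (b).
move: ac ub; rewrite za bT => ac ub.
rewrite [RHS](reindex_onto (fun p : picture_code Om => p.1) (fun F => (F, false))) //=.
apply: eq_big => [[S c]|[S c] pic]; last first.
  have [_ _ c0 _] := picture_startP a_bdry pic.
  by move: pic c0; case: c => // pic _; exact: Proj_picture_start.
rewrite /is_picture eqxx xpair_eqE eqxx /= /corner_config.
have sub1 : (S \subset (~: bdry Om :\ a)%SET) = (S \subset (~: bdry Om)%SET).
  apply/fintype.subsetP/fintype.subsetP => H x xS; have := H x xS; rewrite !inE.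
    by case/andP.
  by move=> xb; rewrite xb andbT; apply: contraNneq xb => ->.
rewrite sub1; case: (boolP (S \subset _)) => //= sS.
have aS : a \notin S by apply/negP => /(fintype.subsetP sS); rewrite !inE a_bdry.
rewrite [RHS]andbC eq_sym; congr andb; first by case: c.
apply: eq_forallb => y; rewrite degreeU1 ?inE //.
rewrite -ub /halves eqxx finset.setU0 eq_sym /=.
have -> : [set h : Om * bool | h.1 \in S]%SET = halves_of S by apply/setP => x;
  rewrite !inE.
by rewrite [tip ha == _]eq_sym; case: (tip y == tip ha); case: (odd _).
Qed.

End FermionProjection.

(** * Projections of the fermion *)

Section Final.
Variables (R : realType) (delta eta : R) (L : isoradial delta eta).
Variable Om : spin_domain L.
Variables a b : Om.
Hypothesis a_bdry : a \in bdry Om.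
Hypothesis b_bdry : b \in bdry Om.
Hypothesis ab_neq : a != b.
Variable Fb : R[i].
Hypothesis Fb_par : parallel Fb (sqrtC (tau b))^-1.
Local Notation ha := (a, true).

(** The imaginary part of (1 + i t) (p + i q) is q + t p, which is nonzero once [t] exceeds all the
    slopes |q / p|. *)
Lemma exists_generic (l : seq R[i]) : (forall x, x \in l -> x != 0) ->
  exists dc : R[i], forall x, x \in l -> complex.Im (dc * x) != 0.
Proof.
move=> l0; pose t := 1 + \sum_(x <- l) `|complex.Im x / complex.Re x|.
exists (1 +i* t) => x xl; have := l0 x xl.
have : `|complex.Im x / complex.Re x| < t.
  rewrite /t (big_rem x) //= addrCA ltrDl ltr_pwDl // sumr_ge0 // => *;
    exact: normr_ge0.
case: x {xl} => p q /=; rewrite mul1r eq_complex negb_and /= => tq pq0.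
case: (eqVneq p 0) pq0 => [->|p0] /= q0; first by rewrite mulr0 addr0.
apply/eqP => E; have qE : q / p = - t.
  by apply: (mulIf p0); rewrite divfK //; lra.
by move: tq; rewrite qE normrN ltNge ler_norm.
Qed.

Lemma sqr_nonneg_real (y : R[i]) (r : R) : 0 <= r -> y ^+ 2 = r%:C -> complex.Im y = 0.
Proof.
case: y => p q r0 /eqP; rewrite expr2 eq_complex /= => /andP[/eqP e1 /eqP e2].
have : p * q = 0 by lra.
move=> /eqP; rewrite mulf_eq0 => /orP[/eqP p0|/eqP //].
by apply/eqP; rewrite -sqrf_eq0; apply/eqP; move: e1; rewrite p0; have := sqr_ge0 q;
  nra.
Qed.

Lemma weight_ge0 (z : Om) p : 0 <= weight a z p.
Proof.
have t0 (x : Om) : 0 <= tan (half_angle x / 2).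
  by have [c0 s0 ->] := half_angle_trig x; rewrite divr_ge0 // ltW.
have [c0 _ _] := half_angle_trig z.
apply: mulr_ge0; last exact: prodr_ge0.
apply: mulr_ge0; last by rewrite invr_ge0 ltW.
by case: ifP.
Qed.

Let K : R[i] := Fb / ((partition_function a b)%:C * cexpi (- (wind_ab a b / 2))).

Lemma fermionE (z : Om) : fermion a b Fb z =
  K * \sum_(p | is_picture a z p) (weight a z p)%:C * cexpi (- (wind (interface a z p)
    / 2)).
Proof.
rewrite /fermion mulrAC -/K; congr (_ * _).
rewrite /expectation mulr_sumr; apply: eq_bigr => p pic.
rewrite mulrA -realCM; congr (_%:C * _).
(* If the partition function vanishes, so does each nonnegative weight, and the default value of the
   division is harmless. *)
have [Z0|Z0] := eqVneq (partition_function a z) 0; last by rewrite mulrC divfK.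
rewrite Z0 mul0r; apply/esym/eqP.
by have /eqP := Z0; rewrite psumr_eq0 => [/allP/(_ p)|*];
  [rewrite mem_index_enum pic => /(_ isT) | exact: weight_ge0].
Qed.

Lemma tauE (z : Om) : tau z = 'i%C * (tan (half_angle z))%:C * (tip (z,
  false) - tip (z, true)).
Proof.
have [E1 E2] := rhombus_shape z.
rewrite /tau; have -> : white2 (Defs.shape z) - white1 (Defs.shape z) =
  (white2 (Defs.shape z) - ctr z) - (white1 (Defs.shape z) - ctr z) by ring.
rewrite E1 E2 -mulrBl /tip /=.
have -> : (0 +i* tan (half_angle z)) - (0 +i* (- tan (half_angle z))) =
   ('i%C * (tan (half_angle z))%:C) + ('i%C * (tan (half_angle z))%:C) :> R[i].
  by apply/eqP; rewrite eq_complex /=; simpc; rewrite ?eqxx.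
by field.
Qed.

Lemma tan_half_angle_gt0 z : 0 < tan (@half_angle _ _ _ L Om z).
Proof.
have /andP[h1 h2] := half_angle_bounds z; have p0 := @pi_gt0 R.
by rewrite /tan divr_gt0 //; [apply: sin_gt0_pi | apply: cos_gt0_pihalf]; apply/andP;
  split; lra.
Qed.

Variable dc : R[i].
Hypothesis dc_generic : forall x y : Om * bool, tip x != tip y ->
  complex.Im (dc * tip x) != complex.Im (dc * tip y).
Variables u w : R[i].
Hypothesis dc_corner : complex.Im (dc * (w - u)) != 0.
Local Notation hdart := (hdart dc).
Local Notation phase := (phase dc).
Local Notation corner := (corner_dart dc u w).
Local Notation nu := ((sqrtC ('i%C * (w - u)))^-1).

Lemma phase_sqr (F : {set Om}) (k d : dart R) : phase F k d ^+ 2 =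
  - (hroot k.2 * (hroot d.2)^*%C) ^+ 2.
Proof.
rewrite /phase !exprMn -exprM mulnC exprM sqrrN expr1n expr1n sqr_i; ring.
Qed.

(** It suffices that the quotient of the two sides by [nu] has a nonnegative real square. *)
Lemma phase_colinear (F : {set Om}) : exists r : R, K * phase F (hdart ha) corner =
  r%:C * nu.
Proof.
(* Without pictures from [a] to [b] the denominator of [K] is 0, hence [K] is 0. *)
rewrite /K /wind_ab; case: pickP => [p pic|none]; last first.
  exists 0; rewrite /partition_function big_pred0 //.
  by rewrite mul0r invr0 mulr0 !mul0r.
have ba : b != a by rewrite eq_sym.
have [_ _ _ ib _] := pictureP a_bdry ba pic.
have p2 : p.2 = true by move: ib; rewrite /inside /inside_half b_bdry /=.
rewrite (interface_phase a_bdry dc_generic ba pic) p2.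
move: Fb_par => [t ->]; set Z := partition_function a b.
set e := (b, true); set X := _ * _.
have c0 : 'i%C * (w - u) != 0.
  apply: contraNneq dc_corner => /eqP; rewrite mulf_eq0 => /orP[|/eqP ->];
    last by rewrite mulr0.
  by rewrite eq_complex /= eqxx oner_eq0.
have s0 : sqrtC ('i%C * (w - u)) != 0 by rewrite sqrtC_eq0.
pose nk := Normc.normc (dc * (w - u)); pose ne := Normc.normc (hdart e).2.
have nk0 : 0 < nk by apply: normc_gt0.
have ne0 : 0 < ne by apply: normc_gt0; exact: hdart_Im.
have tb := tan_half_angle_gt0 b.
(* Squaring removes the signs of the phases and the choice of the roots. The squared [hroot] factors
   cancel against [w - u] and against the edge at [b], which [tauE] makes orthogonal to [tau b]. *)
have X2 : (X * sqrtC ('i%C * (w - u))) ^+ 2 =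
  (t ^+ 2 * nk / (Z ^+ 2 * ne * tan (half_angle b)))%:C.
  have [Z0|Z0] := eqVneq Z 0.
    by rewrite /X Z0 !expr2 !(mul0r, mulr0, invr0).
  have nz (v : R[i]) : hroot v != 0.
    by apply/eqP => h0; have := unimodV (hroot_unimod v); rewrite h0 mul0r => /eqP;
      rewrite eq_sym oner_eq0.
  have cV (v : R[i]) : (hroot v)^*%C = (hroot v)^-1.
    by apply: (mulfI (nz v)); rewrite unimodV ?mulfV //; apply: hroot_unimod.
  have d0 := dc_neq0 dc_generic e.
  have Ek : w - u = dc^-1 * (nk%:C * hroot corner.2 ^+ 2).
    by rewrite -hrootE ?mulKf.
  have Ee : tip (b, false) - tip (b, true) = dc^-1 * (ne%:C * hroot (hdart e).2 ^+ 2).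
    by rewrite -hrootE ?mulKf //; apply: hdart_Im.
  have rC (x : R) : x != 0 -> x%:C != 0 :> R[i].
    by move=> x0; rewrite -(rmorph0 (real_complex R)) (inj_eq (@complexI R)).
  have E : X ^+ 2 = t%:C ^+ 2 / tau b * (phase F (hdart ha) corner ^+ 2 / phase p.1
    (hdart ha) (hdart e) ^+ 2) / Z%:C ^+ 2.
    rewrite /X -[tau b in RHS]sqrtCK.
    by rewrite !exprMn !exprVn !exprMn !invfM; ring.
  rewrite exprMn sqrtCK E tauE Ee !phase_sqr !cV Ek.
  have -> : (t ^+ 2 * nk / (Z ^+ 2 * ne * tan (half_angle b)))%:C =
     t%:C ^+ 2 * nk%:C / (Z%:C ^+ 2 * ne%:C * (tan (half_angle b))%:C) :> R[i].
    by rewrite !realCM fmorphV /= !realCM !expr2.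
  have := nz (hdart ha).2; have := nz (hdart e).2; have := nz corner.2.
  have := rC _ (lt0r_neq0 nk0); have := rC _ (lt0r_neq0 ne0); have := rC _ Z0;
    have := rC _ (lt0r_neq0 tb).
  have i0 : 'i%C != 0 :> R[i] by rewrite eq_complex /= eqxx oner_eq0.
  move: (hroot _) (hroot _) (hroot _) (Z%:C) (nk%:C) (ne%:C) ((tan _)%:C) (t%:C) 'i%C
    i0 d0 => s1 s2 s3 z1 z2 z3 z4 z5 z6 i0 d0 *.
  by field; do ?[apply/andP; split].
have y0 := sqr_nonneg_real _ X2.
exists (complex.Re (X * sqrtC ('i%C * (w - u)))).
rewrite -[X in X = _](mulfK s0); congr (_ * _).
have {}y0 : complex.Im (X * sqrtC ('i%C * (w - u))) = 0.
  apply: y0; apply: divr_ge0; first by apply: mulr_ge0; [exact: sqr_ge0 | exact: ltW].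
  by apply: mulr_ge0; [apply: mulr_ge0; [exact: sqr_ge0 | exact: ltW] | exact: ltW].
by case: (X * _) y0 => ? ? /= ->.
Qed.

End Final.

Theorem proposition2p5 (R : realType) (delta eta : R) (L : isoradial delta eta)
    (Om : spin_domain L) (a b : Om)
    (a_bdry : a \in bdry Om) (b_bdry : b \in bdry Om) (ab_neq : a != b)
    (Fb : R[i]) (Fb_neq0 : Fb != 0) (Fb_par : parallel Fb (sqrtC (tau b))^-1)
    (z0 z1 : Om) (u w1 : R[i]) (z_neq : z0 != z1)
    (edge0 : lambda_edge z0 u w1) (edge1 : lambda_edge z1 u w1) :
  Proj (fermion a b Fb z0) (sqrtC ('i%C * (w1 - u)))^-1 =
  Proj (fermion a b Fb z1) (sqrtC ('i%C * (w1 - u)))^-1.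
Proof.
have wu0 : w1 - u != 0.
  have [c [_ [_ Ww uw _ _]]] := lambda_edge_corner edge0.
  have := face_circle Ww uw; have := delta_gt0 L.
  move=> d0 E; apply/eqP => /eqP; rewrite subr_eq0 => /eqP wu.
  by move: d0; rewrite -E wu subrr Normc.normc0 ltxx.
(* The vectors that must not become horizontal: the corner direction and all differences of distinct
   vertices. *)
pose l : seq R[i] := (w1 - u) ::
  [seq d <- [seq tip yx.1 - tip yx.2 | yx : (Om * bool) * (Om * bool)] | d != 0].
have [|dc dcl] := @exists_generic _ l.
  by move=> x; rewrite inE mem_filter => /orP[/eqP -> //|/andP[]].
have dc_corner : complex.Im (dc * (w1 - u)) != 0 by apply: dcl; rewrite mem_head.
have dc_generic (x y : Om * bool) : tip x != tip y ->
    complex.Im (dc * tip x) != complex.Im (dc * tip y).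
  move=> xy; have : complex.Im (dc * (tip x - tip y)) != 0.
    apply: dcl; rewrite inE mem_filter subr_eq0 xy /=; apply/orP; right.
    by apply/mapP; exists (x, y); rewrite ?mem_enum.
  by apply: contra_neq => E; rewrite mulrBr;
    case: (dc * tip x) (dc * tip y) E => p q [p' q'] /= ->; rewrite subrr.
have nu0 : (sqrtC ('i%C * (w1 - u)))^-1 != 0.
  by rewrite invr_eq0 sqrtC_eq0 mulf_neq0 // eq_complex /= eqxx oner_eq0.
have col := phase_colinear a_bdry b_bdry ab_neq Fb_par dc_generic dc_corner.
(* Both projections equal the same [corner_sum]. *)
by rewrite !fermionE !(Proj_picture_sum a_bdry dc_generic dc_corner nu0 col).
Qed.
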